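(* For any randomized algorithm $\mathsf A$ (in the incremental higher-order oracle model), any $\Delta$, $L_2$, $\varepsilon$, and any $n\le\frac{c\,\Delta^{12/7}L_2^{6/7}}{\varepsilon^{18/7}}$, there exist a dimension $d\le\tilde{\mathcal O}(n^2\Delta L_2\varepsilon^{-3})$ and a function $F=\frac1n\sum_{i=1}^nf_i$ (with domain $\mathbb R^d$) that satisfies the third-moment smoothness assumption with constant $L_2$ and initial gap $\Delta$ (defined in the context) such that $$T_\varepsilon(\mathsf A,F)\ \ge\ \Omega\left(\frac{L_2^{1/2}\,\Delta\,n^{5/12}}{\varepsilon^{3/2}}\right),$$ where the constants hidden by $\Omega$ do not depend on $\varepsilon$ or $n$, and $c$ is also a universal constant.
   Context: Here $n\ge1$ is an integer and $\Delta,L_2,\varepsilon>0$. $\|\cdot\|$ is the Euclidean norm for vectors and the spectral norm for matrices. Third-moment smoothness assumption with constant $L_2$ and initial gap $\Delta$: $F=\frac1n\sum_{i=1}^nf_i$ with $f_i:\mathbb R^d\to\mathbb R$ (having Hessians $\nabla^2f_i$) such that for any $\mathbf x,\mathbf y\in\mathbb R^d$, $\left(\mathbb E_i\|\nabla^2f_i(\mathbf x)-\nabla^2f_i(\mathbf y)\|^3\right)^{1/3}\le L_2\|\mathbf x-\mathbf y\|$, where $\mathbb E_i$ is the expectation over $i$ uniform on $[n]$; moreover $F(\mathbf 0)-\inf_{\mathbf x}F(\mathbf x)\le\Delta$. Oracle and algorithms (incremental higher-order oracle model). For an arbitrary order $q$, the oracle for $F$ maps $(i,\mathbf x)\in[n]\times\mathbb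 R^d$ to $\nabla^{(0:q)}f_i(\mathbf x)$, the collection of the value and all derivative tensors of $f_i$ at $\mathbf x$ of orders up to $q$ (the oracle is considered for functions for which these derivatives exist). An algorithm $\mathsf A$ has access to an infinite sequence of random bits $\xi\sim\mathcal U([0,1])$ drawn at the beginning and consists of a sequence of mappings $A^{(t)}$, $t\in\mathbb N$, producing indices $i^t\in[n]$ and iterates $\mathbf x^{(t)}\in\mathbb R^d$ from previous oracle responses: $$[i^t,\mathbf x^{(t)}]=A^{(t)}\{\xi,\,i^{0:t-1},\,\mathbf x^{(0:t-1)},\,\nabla^{(0:q)}f_{i^0}(\mathbf x^{(0)}),\dots,\nabla^{(0:q)}f_{i^{t-1}}(\mathbf x^{(t-1)})\},$$ with $\mathbf x^{(0)}=\mathbf 0$ and no restriction on how $i^0$ is chosen. An algorithm can be run on functions of any dimension $d$. Complexity. $T_\varepsilon(\mathsf A,F)$ is the infimum over all $t\in\mathbb N$ such that the event ''$\|\nabla F(\mathbf x^{(s)})\|>\varepsilon$ for all $s\le t$'' has probability at most $\frac12$, where $\mathbf x^{(s)}$ are the iterates of $\mathsf A$ run on $F$ (probability over $\xi$). Notation. $\tilde{\mathcal O}$ hides, in addition to constants, polylogarithmic factors in $d$, $n$ and $1/\varepsilon$.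
   Formalization: The constant hidden in the bound d ≤ Õ(n²ΔL₂ε⁻³) may depend on Δ (not on L₂, ε, n, or the algorithm); an absolute constant is impossible, since rescaling F by λ→∞ would force d = 0. *)

(* Defs.v *)
From HB Require Import structures.
From mathcomp Require Import all_boot all_order all_algebra.
From mathcomp Require Import all_classical all_reals all_analysis.

Set Implicit Arguments.
Unset Strict Implicit.
Unset Printing Implicit Defensive.

Import Order.TTheory GRing.Theory Num.Theory.
Import numFieldNormedType.Exports.

Local Open Scope classical_set_scope.
Local Open Scope ring_scope.

(* The library norm `|v| on 'rV[R]_d is the sup norm, so the Euclidean norm is
   introduced separately; the two induce the same topology, hence the same
   notions of differentiability and of derivative. *)
Definition enorm (R : realType) (d : nat) (v : 'rV[R]_d) : R :=
  Num.sqrt (\sum_j v ord0 j ^+ 2).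

(* Matrices act on row vectors; the operator norm of v |-> v *m A is that of
   its transpose, so this is the usual spectral norm. *)
Definition spectral_norm (R : realType) (d : nat) (A : 'M[R]_d) : R :=
  sup [set enorm (v *m A) | v in [set v : 'rV[R]_d | enorm v <= 1]].

Section derivatives.
Variables (R : realType) (d : nat).
Implicit Types (f : 'rV[R]_d -> R) (x : 'rV[R]_d).

Definition partial (j : 'I_d) f : 'rV[R]_d -> R :=
  fun x => 'D_(delta_mx ord0 j) f x.

(* iter_partial [:: j1; ...; jk] f x is the entry of index (j1, ..., jk) of the
   k-th derivative tensor of f at x. *)
Definition iter_partial (J : seq 'I_d) f : 'rV[R]_d -> R :=
  foldr partial f J.

(* f is k times (Frechet) differentiable everywhere: all its partial derivatives
   of order < k are differentiable. *)
Definition times_differentiable (k : nat) f : Prop :=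
  forall J : seq 'I_d, (size J < k)%N ->
  forall x, differentiable (iter_partial J f) x.

Definition gradient f x : 'rV[R]_d := \row_j partial j f x.

Definition hessian f x : 'M[R]_d := \matrix_(i, j) iter_partial [:: i; j] f x.

(* The tensors of orders 0, ..., q at a point, given by their entries. *)
Definition tensors (q : nat) : Type :=
  forall k : 'I_q.+1, k.-tuple 'I_d -> R.

Definition derivatives_upto (q : nat) f x : tensors q :=
  fun k J => iter_partial J f x.

Definition average (n : nat) (f : 'I_n -> 'rV[R]_d -> R) : 'rV[R]_d -> R :=
  fun x => n%:R^-1 * \sum_(i < n) f i x.

Definition third_moment_smooth (n : nat) (L2 : R)
    (f : 'I_n -> 'rV[R]_d -> R) : Prop :=
  (forall i, times_differentiable 2 (f i)) /\
  forall x y,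
    (n%:R^-1 *
       \sum_(i < n) spectral_norm (hessian (f i) x - hessian (f i) y) ^+ 3)
      `^ (3^-1) <= L2 * enorm (x - y).

(* The infimum is taken in the extended reals, so that the condition fails when
   F is unbounded below. *)
Definition initial_gap_le (Delta : R) (F : 'rV[R]_d -> R) : Prop :=
  ((F 0)%:E - ereal_inf (range (EFin \o F)) <= Delta%:E)%E.

End derivatives.

Arguments derivatives_upto {R d} q f x _ _ : rename.

Section oracle_model.
Variables (R : realType) (q n : nat).

(* One round: the queried index, the queried point, and the oracle response. *)
Definition round (d : nat) : Type := ('I_n * 'rV[R]_d * tensors R d q)%type.

(* What the t-th mapping of an algorithm sees: the random seed and the t
   previous rounds. *)
Definition transcript (d t : nat) : Type := (R * t.-tuple (round d))%type.

(* Generators of the product (Borel) sigma-algebra on transcripts: the preimages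
   of measurable sets under all the coordinates (indices are seen in nat, whose
   measurable structure is discrete). *)
Definition cylinders (d t : nat) : set (set (transcript d t)) :=
  preimage_set_system setT (fun h : transcript d t => h.1) measurable
  `|` \bigcup_(s in [set: 'I_t])
        (preimage_set_system setT
           (fun h : transcript d t => nat_of_ord (tnth h.2 s).1.1) measurable
         `|` \bigcup_(j in [set: 'I_d])
               preimage_set_system setT
                 (fun h : transcript d t => (tnth h.2 s).1.2 ord0 j) measurable
         `|` \bigcup_(k in [set: 'I_q.+1]) \bigcup_(J in [set: k.-tuple 'I_d])
               preimage_set_system setT
                 (fun h : transcript d t => (tnth h.2 s).2 k J) measurable).

(* The mappings are required to be measurable, so that events about the iterates
   have a probability. *)
Record algorithm := Algorithm {
  step : forall d t : nat, transcript d t -> 'I_n * 'rV[R]_d;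
  step_index_measurable : forall d t : nat,
    preimage_set_system setT
      (fun h : transcript d t => nat_of_ord (step h).1) measurable
    `<=` <<s @cylinders d t >>;
  step_point_measurable : forall (d t : nat) (j : 'I_d),
    preimage_set_system setT
      (fun h : transcript d t => (step h).2 ord0 j) measurable
    `<=` <<s @cylinders d t >>;
  step_start : forall (d : nat) (h : transcript d 0), (step h).2 = 0 }.

Variables (A : algorithm) (d : nat) (f : 'I_n -> 'rV[R]_d -> R).

Definition play (t : nat) (h : transcript d t) : round d :=
  let ix := step A h in (ix, derivatives_upto q (f ix.1) ix.2).

Fixpoint history (xi : R) (t : nat) : t.-tuple (round d) :=
  match t with
  | 0 => [tuple]
  | s.+1 => [tuple of rcons (history xi s) (play (xi, history xi s))]
  end.

Definition iterate (xi : R) (t : nat) : 'rV[R]_d :=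
  (step A (xi, history xi t)).2.

Definition no_stationary_until (eps : R) (t : nat) : set R :=
  [set xi | forall s : nat, (s <= t)%N ->
     eps < enorm (gradient (average f) (iterate xi s))].

(* The seed is uniform on [0, 1]. The infimum is +oo if no t qualifies. *)
Definition complexity (eps : R) : \bar R :=
  ereal_inf
    [set (t%:R)%:E | t in
      [set t : nat |
        (uniform_prob (@ltr01 R) (no_stationary_until eps t) <= (2^-1)%:E)%E]].

End oracle_model.

(* Main.v *)
(* Each f_i is a chain of m + 1 blocks of fresh coordinates, every block hiding
   a codeword of a finite code. The link between consecutive blocks is a bump
   around the codeword of the first one times a Gaussian around the codeword of
   the second, and a small ridge makes the gradient large as long as some block
   is far from its codeword. As a bump vanishes identically away from its centre,
   a query to f_i reveals at most one new codeword, unless the algorithm guesses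
   one. The bumps around different codewords are disjoint, so for fixed random
   bits and fixed other codewords at most one codeword of a given block can be
   guessed at a given time; a union bound then shows that most choices of
   codewords are never guessed in the first n m / 2 rounds, after which half of
   the chains are still unsolved. Averaging over the random bits gives one choice
   that works with probability more than 1/2. As different f_i act on different
   coordinates, the third moments add up as cubes of Euclidean norms, which gains
   the factor n^(1/3) in the Hessian Lipschitz constant of each chain. *)

Require Import Defs.
From mathcomp Require Import all_boot all_order all_algebra.
From mathcomp Require Import all_classical all_reals all_analysis.
From mathcomp Require Import measurable_realfun.
From mathcomp Require Import lra ring zify.

Set Implicit Arguments.
Unset Strict Implicit.
Unset Printing Implicit Defensive.

Import Order.TTheory GRing.Theory Num.Theory.
Import numFieldNormedType.Exports.

Local Open Scope ring_scope.

(** * Smooth functions *)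

Section Smooth.
Context {R : realType} {d : nat}.
Implicit Types (f g : 'rV[R]_d -> R) (x v w z : 'rV[R]_d).

(** A profile is carried together with all its derivatives, so that differentiating a composition
    stays within the constructors of [smooth]. *)
Definition jet (h : nat -> R -> R) : Prop :=
  forall k s, is_derive s (1 : R) (h k) (h k.+1 s).

(* A class of functions that is visibly stable under directional derivatives. *)
Inductive smooth : ('rV[R]_d -> R) -> Prop :=
| smooth_cst c : smooth (fun=> c)
| smooth_coord a : smooth (fun x => x ord0 a)
| smooth_add f g : smooth f -> smooth g -> smooth (fun x => f x + g x)
| smooth_mul f g : smooth f -> smooth g -> smooth (fun x => f x * g x)
| smooth_comp h k f : jet h -> smooth f -> smooth (fun x => h k (f x)).

Lemma jet_differentiable h k s : jet h -> differentiable (h k) s.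
Proof. by move=> hj; apply/derivable1_diffP; have [] := hj k s. Qed.

Lemma smooth_differentiable f x : smooth f -> differentiable f x.
Proof.
elim=> {f} [c|a|f g _ df _ dg|f g _ df _ dg|h k f hj _ df].
- exact: differentiable_cst.
- exact: differentiable_coord.
- exact: differentiableD.
- exact: differentiableM.
- by apply: differentiable_comp => //; exact: jet_differentiable.
Qed.

Lemma smooth_continuous f : smooth f -> continuous f.
Proof. by move=> sf x; apply/differentiable_continuous/smooth_differentiable. Qed.

Lemma smooth_derivable f x v : smooth f -> derivable f x v.
Proof. by move=> sf; apply/diff_derivable/smooth_differentiable. Qed.

Lemma derive_coord a v x : 'D_v (fun y : 'rV[R]_d => y ord0 a) x = v ord0 a.
Proof.
have /matrixP/(_ ord0 a) := derive_mx (@derivable_id _ _ x v).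
by rewrite derive_id mxE.
Qed.

Lemma derive_smoothD f g x v : smooth f -> smooth g ->
  'D_v (fun y => f y + g y) x = 'D_v f x + 'D_v g x.
Proof. by move=> sf sg; apply: deriveD; exact: smooth_derivable. Qed.

Lemma derive_smoothM f g x v : smooth f -> smooth g ->
  'D_v (fun y => f y * g y) x = f x * 'D_v g x + g x * 'D_v f x.
Proof. by move=> sf sg; apply: deriveM; exact: smooth_derivable. Qed.

Lemma derive_smooth_comp h k f x v : jet h -> smooth f ->
  'D_v (fun y => h k (f y)) x = h k.+1 (f x) * 'D_v f x.
Proof.
move=> hj sf; have df := @smooth_differentiable f x sf.
have dh := @jet_differentiable h k (f x) hj.
rewrite deriveE; last exact: (differentiable_comp df dh).
rewrite (diff_comp df dh) /= deriv1E; last by have [] := hj k (f x).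
by rewrite derive1E (@derive_val _ _ _ _ _ _ _ (hj k (f x))) -deriveE// mulrC.
Qed.

Lemma smooth_derive f v : smooth f -> smooth ('D_v f).
Proof.
elim=> {f} [c|a|f g sf sdf sg sdg|f g sf sdf sg sdg|h k f hj sf sdf].
- rewrite (_ : 'D_v _ = fun=> 0); first exact: smooth_cst.
  by apply/funext => x; rewrite derive_cst.
- rewrite (_ : 'D_v _ = fun=> v ord0 a); first exact: smooth_cst.
  by apply/funext => x; rewrite derive_coord.
- rewrite (_ : 'D_v _ = fun x => 'D_v f x + 'D_v g x); first exact: smooth_add.
  by apply/funext => x; rewrite derive_smoothD.
- rewrite (_ : 'D_v _ = fun x => f x * 'D_v g x + g x * 'D_v f x).
    by apply: smooth_add; exact: smooth_mul.
  by apply/funext => x; rewrite derive_smoothM.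
- rewrite (_ : 'D_v _ = fun x => h k.+1 (f x) * 'D_v f x).
    by apply: smooth_mul => //; exact: smooth_comp.
  by apply/funext => x; rewrite derive_smooth_comp.
Qed.

Lemma smooth_iter_partial J f : smooth f -> smooth (iter_partial J f).
Proof. by move=> sf; elim: J => //= a J sJ; exact: smooth_derive. Qed.

Lemma smooth_times_differentiable k f : smooth f -> times_differentiable k f.
Proof.
by move=> sf J _ x; apply/smooth_differentiable/smooth_iter_partial.
Qed.

Lemma derive_partial f x v : smooth f ->
  'D_v f x = \sum_a v ord0 a * partial a f x.
Proof.
move=> sf; have df := @smooth_differentiable f x sf.
rewrite deriveE// [in LHS](row_sum_delta v) linear_sum/=; apply: eq_bigr => a _.
by rewrite linearZ/= /partial deriveE.
Qed.

Lemma smooth_sum (T : Type) (r : seq T) (F : T -> 'rV[R]_d -> R) :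
  (forall t, smooth (F t)) -> smooth (fun x => \sum_(t <- r) F t x).
Proof.
move=> sF; elim: r => [|t r sr].
  rewrite (_ : (fun x => _) = fun=> 0); first exact: smooth_cst.
  by apply/funext => x; rewrite big_nil.
rewrite (_ : (fun x => _) = fun x => F t x + \sum_(i <- r) F i x).
  exact: smooth_add.
by apply/funext => x; rewrite big_cons.
Qed.

Lemma derive_smooth_sum (T : Type) (r : seq T) (F : T -> 'rV[R]_d -> R) x v :
  (forall t, smooth (F t)) ->
  'D_v (fun x => \sum_(t <- r) F t x) x = \sum_(t <- r) 'D_v (F t) x.
Proof.
move=> sF; elim: r => [|t r IH].
  rewrite (_ : (fun x => _) = fun=> 0) ?derive_cst ?big_nil//.
  by apply/funext => y; rewrite big_nil.
rewrite (_ : (fun x => _) = fun x => F t x + \sum_(i <- r) F i x).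
  by rewrite derive_smoothD// ?IH ?big_cons//; exact: smooth_sum.
by apply/funext => y; rewrite big_cons.
Qed.

Lemma derive_smoothZ c f x v : smooth f ->
  'D_v (fun y => c * f y) x = c * 'D_v f x.
Proof.
move=> sf; rewrite derive_smoothM//; last exact: smooth_cst.
by rewrite derive_cst mulr0 addr0.
Qed.

Lemma smoothZ c f : smooth f -> smooth (fun y => c * f y).
Proof. by move=> sf; apply: smooth_mul => //; exact: smooth_cst. Qed.

(** The conclusion is stated near [x] rather than at [x] because the next differentiation needs the
    equality on a neighbourhood. *)
Lemma near_eq_iter_partial J f g x :
  (\forall y \near x, f y = g y) ->
  \forall y \near x, iter_partial J f y = iter_partial J g y.
Proof.
elim: J => //= a J IH /IH /nbhs_interior; apply: filterS => y fg.
exact: near_eq_derive.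
Qed.

End Smooth.

(** * Bump and Gaussian profiles *)

Section Profiles.
Local Open Scope classical_set_scope.
Local Open Scope ring_scope.
Context {R : realType}.
Implicit Types (p : {poly R}) (s t : R).

(* The derivative of p(1/t) exp(-1/t) is r(1/t) exp(-1/t), r = X^2 (p - p'). *)
Definition flat p t : R := if 0 < t then p.[t^-1] * expR (- t^-1) else 0.

Definition flat_next p : {poly R} := 'X^2 * (p - p^`()).

(** With s = 1/t > 0, each monomial satisfies s^i exp(-s) <= i!, from a single term of the
    exponential series. *)
Lemma flat_bounded p : exists2 B : R, 0 <= B & forall t, `|flat p t| <= B.
Proof.
exists (\sum_(i < size p) `|p`_i| * i`!%:R).
  by apply: sumr_ge0 => i _; rewrite mulr_ge0.
move=> t; rewrite /flat; case: ifPn => [t0|_]; last first.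
  by rewrite normr0 sumr_ge0// => i _; rewrite mulr_ge0.
have s0 : 0 < t^-1 by rewrite invr_gt0.
rewrite horner_coef normrM (ger0_norm (expR_ge0 _)) expRN.
rewrite ler_pdivrMr ?expR_gt0//.
rewrite mulr_suml (le_trans (ler_norm_sum _ _ _))//; apply: ler_sum => i _.
rewrite normrM -mulrA ler_wpM2l// ger0_norm ?exprn_ge0 ?(ltW s0)//.
case: (nat_of_ord i) => [|k].
  by rewrite fact0 mul1r expr0 -expR0 ler_expR ltW.
rewrite mulrC -ler_pdivrMr ?ltr0n ?fact_gt0//.
by rewrite (le_trans _ (expR_ge1Dxn k (ltW s0)))// lerDr.
Qed.

(** The second factor is bounded, so the difference quotient at 0 is O(t); this settles the junction
    point in [is_derive_flat]. *)
Lemma flat_sqr p t : flat p t = t ^+ 2 * flat ('X^2 * p) t.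
Proof.
rewrite /flat; case: ifPn => [t0|_]; last by rewrite mulr0.
by rewrite hornerM hornerXn exprVn; field; rewrite gt_eqF.
Qed.

Lemma is_derive_flat p t : is_derive t (1 : R) (flat p) (flat (flat_next p) t).
Proof.
have [t0|t0|->] := ltgtP t 0.
- have -> : flat (flat_next p) t = 0 by rewrite /flat ltNge (ltW t0).
  apply: (@near_eq_is_derive _ _ _ (cst 0)).
  near=> y; rewrite /flat ltNge (_ : y <= 0)//.
  by near: y; exact: lt_le_nbhsl.
- apply: (@near_eq_is_derive _ _ _ (fun y : R => p.[y^-1] * expR (- y^-1))).
    near=> y; rewrite /flat (_ : 0 < y)//.
    by near: y; exact: lt_nbhsr.
  have dV : is_derive t (1 : R) (fun y : R => y^-1) (- t ^- 2).
    have := @is_deriveV R id t 1 1; rewrite /= /GRing.scale/= mulr1.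
    by apply; rewrite gt_eqF.
  have dNV : is_derive t (1 : R) (fun y : R => - y^-1) (t ^- 2).
    by rewrite -[t ^- 2]opprK; exact: is_deriveN.
  have d1 : is_derive t (1 : R) (fun y : R => p.[y^-1])
      (p^`().[t^-1] * (- t ^- 2)).
    exact: (@is_derive1_comp _ (horner p) (fun y : R => y^-1)).
  have d2 : is_derive t (1 : R) (fun y : R => expR (- y^-1))
      (expR (- t^-1) * t ^- 2).
    exact: (@is_derive1_comp _ expR (fun y : R => - y^-1)).
  apply: (is_derive_eq (is_deriveM d1 d2)); rewrite /flat t0 /GRing.scale/=.
  by rewrite hornerM hornerXn hornerD hornerN exprVn; ring.
- have -> : flat (flat_next p) 0 = 0 by rewrite /flat ltxx.
  have [B B0 pB] := flat_bounded ('X^2 * p).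
  suff lim0 : h^-1 *: (flat p (h *: (1 : R) + 0) - flat p 0) @[h --> 0^']
      --> (0 : R).
    apply: DeriveDef; first by apply/cvg_ex; exists 0.
    exact: cvg_lim lim0.
  apply/cvgrPdist_le => e e0; near=> h.
  have h0 : h != 0 by near: h; exact: nbhs_dnbhs_neq.
  rewrite /GRing.scale/= mulr1 addr0 {2}/flat ltxx subr0 sub0r normrN.
  rewrite flat_sqr mulrA expr2 mulrA mulVf// mul1r normrM.
  rewrite (@le_trans _ _ (`|h| * (B + 1)))//.
    by rewrite ler_wpM2l// (le_trans (pB h))// lerDl.
  rewrite -ler_pdivlMr ?ltr_wpDl//.
  by near: h; apply: dnbhs0_le; rewrite divr_gt0// ltr_wpDl.
Unshelve. all: by end_near. Qed.

Lemma is_derive_expRN t :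
  is_derive t (1 : R) (fun s => expR (- s)) (- expR (- t)).
Proof.
apply: (is_derive_eq (@is_derive1_comp _ expR -%R t _ _ _ _)).
by rewrite mulrN1.
Qed.

(** Profiles are evaluated at a squared distance s. Up to order three the chain rule brings out
    powers of sqrt s up to s^(3/2), all dominated by the weight (1 + s)^2. *)
Definition decay_bound (B : R) (h : nat -> R -> R) : Prop :=
  forall k s, (k <= 3)%N -> 0 <= s -> `|h k s| * (1 + s) ^+ 2 <= B.

Definition gaussian_jet (k : nat) s : R := (-1) ^+ k * expR (- s).

Lemma gaussian_jetP : jet gaussian_jet.
Proof.
move=> k s; have h := is_derive_expRN s.
apply: (is_derive_eq (is_deriveZ ((-1) ^+ k) h)).
by rewrite /gaussian_jet /GRing.scale/= exprS mulN1r mulrN mulNr.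
Qed.

(** Squaring 1 + s <= 2 exp(s/2) gives the constant 4. *)
Lemma gaussian_jet_bounded : decay_bound 4 gaussian_jet.
Proof.
move=> k s _ s0; rewrite normrM normrX normrN1 expr1n mul1r ger0_norm ?expR_ge0//.
have h : 1 + s <= 2 * expR (s / 2).
  by have := expR_ge1Dx (s / 2); have := s0; lra.
have -> : expR (- s) = (expR (s / 2) ^+ 2)^-1.
  by rewrite expRN -expRM_natl; congr (expR _)^-1; field.
rewrite mulrC ler_pdivrMr ?exprn_gt0 ?expR_gt0//.
have -> : 4 * expR (s / 2) ^+ 2 = (2 * expR (s / 2)) ^+ 2 :> R by ring.
by rewrite ler_sqr ?nnegrE ?addr_ge0// mulr_ge0 ?expR_ge0.
Qed.

(** At order 0 this is exp(-1/(1/3 - s)) for s < 1/3 and 0 beyond. The cutoff 1/3 lies strictly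
    between 1/8, the level of a solved block in the gradient bound, and 1/2, the threshold of
    [hit]. *)
Definition bump_jet (k : nat) s : R :=
  (-1) ^+ k * flat (iter k flat_next 1) (3^-1 - s).

Lemma bump_jetP : jet bump_jet.
Proof.
move=> k s; rewrite /bump_jet.
have ds : is_derive s (1 : R) (fun s : R => 3^-1 - s) (-1).
  have : is_derive s (1 : R) (cst (3^-1 : R) - id) (0 - 1) by exact: is_deriveB.
  by rewrite sub0r.
have h := @is_derive1_comp _ (flat (iter k flat_next 1))
  (fun s : R => 3^-1 - s) s _ _
  (is_derive_flat (iter k flat_next 1) (3^-1 - s)) ds.
apply: (is_derive_eq (is_deriveZ ((-1) ^+ k) h)).
by rewrite /GRing.scale/= exprS; ring.
Qed.

(** On the support s < 1/3, so the weight is at most 4; summing the bounds of the four orders gives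
    one that serves them all. *)
Lemma bump_jet_bounded : exists2 B : R, 0 <= B & decay_bound B bump_jet.
Proof.
have b k := cid2 (flat_bounded (iter k flat_next 1)).
exists (4 * \sum_(k < 4) sval (b k)).
  by rewrite mulr_ge0// sumr_ge0// => k _; case: (b k).
move=> k s k3 s0; have [B0 hB] := svalP (b k).
have le_sum : sval (b k) <= \sum_(k < 4) sval (b k).
  rewrite (bigD1 (inord k))//= inordK// lerDl sumr_ge0// => j _.
  by case: (b j).
rewrite /bump_jet normrM normrX normrN1 expr1n mul1r.
have [s3|s3] := ltP s (3^-1); last first.
  rewrite /flat ltNge subr_le0 s3/= normr0 mul0r mulr_ge0//.
  exact: le_trans B0 le_sum.
rewrite mulrC ler_pM// ?exprn_ge0 ?addr_ge0//.
  by rewrite (_ : 4 = 2 ^+ 2 :> R) ?ler_sqr ?nnegrE ?addr_ge0//; [lra|ring].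
by rewrite (le_trans (hB _)).
Qed.

Lemma bump_jet_eq0 k s : 3^-1 <= s -> bump_jet k s = 0.
Proof. by move=> s3; rewrite /bump_jet /flat ltNge subr_le0 s3/= mulr0. Qed.

Lemma bump_jet0E s : bump_jet 0 s = flat 1 (3^-1 - s).
Proof. by rewrite /bump_jet expr0 mul1r. Qed.

Lemma flat1_ge0 t : 0 <= flat 1 t.
Proof.
by rewrite /flat; case: ifP => // _; rewrite hornerC mul1r expR_ge0.
Qed.

Lemma flat1_le1 t : flat 1 t <= 1.
Proof.
rewrite /flat; case: ifPn => // t0; rewrite hornerC mul1r -expR0 ler_expR.
by rewrite oppr_le0 invr_ge0 ltW.
Qed.

Lemma flat1_homo : {homo flat 1 : s t / s <= t}.
Proof.
move=> s t st; rewrite {1}/flat; case: ifPn => s0; last exact: flat1_ge0.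
have t0 := lt_le_trans s0 st.
by rewrite /flat t0 !hornerC !mul1r ler_expR lerN2 lef_pV2.
Qed.

(* The bump is nonincreasing because its first derivative is -flat 'X^2. *)
Lemma bump_jet1_le0 s : bump_jet 1 s <= 0.
Proof.
rewrite /bump_jet expr1 mulN1r oppr_le0 /= /flat; case: ifP => // _.
by rewrite /flat_next derivC subr0 mulr1 hornerXn mulr_ge0 ?expR_ge0 ?sqr_ge0.
Qed.

Lemma decay_bound_ge0 (h : nat -> R -> R) B : decay_bound B h -> 0 <= B.
Proof.
move=> /(_ 0%N 0 isT (lexx _)); apply: le_trans.
by rewrite mulr_ge0 ?sqr_ge0.
Qed.

Lemma decay_boundW (h : nat -> R -> R) B B' :
  decay_bound B h -> B <= B' -> decay_bound B' h.
Proof. by move=> hB BB' k s k3 s0; apply: le_trans (hB k s k3 s0) BB'. Qed.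

End Profiles.

(** * Third derivatives of the chain *)

Section CauchySchwarz.
Context {R : realType} {T : finType}.
Implicit Types (a b : T -> R).

Lemma sum_sqr_ge0 a : 0 <= \sum_t a t ^+ 2.
Proof. by apply: sumr_ge0 => t _; exact: sqr_ge0. Qed.

(** The vector a B - b S, with S the inner product and B the squared norm of b, has squared norm B
    (A B - S^2), which is nonnegative. If B = 0 then b vanishes. *)
Lemma cauchy_schwarz_sqr a b :
  (\sum_t a t * b t) ^+ 2 <= (\sum_t a t ^+ 2) * (\sum_t b t ^+ 2).
Proof.
set S := \sum_t a t * b t; set A := \sum_t a t ^+ 2; set B := \sum_t b t ^+ 2.
have [B0|B0] := eqVneq B 0.
  suff -> : S = 0 by rewrite expr0n/= mulr_ge0// sum_sqr_ge0.
  apply: big1 => t _; suff -> : b t = 0 by rewrite mulr0.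
  apply/eqP; rewrite -sqrf_eq0; apply/eqP.
  by apply: (psumr_eq0P _ B0) => // i _; exact: sqr_ge0.
have Bgt0 : 0 < B by rewrite lt_neqAle eq_sym B0 sum_sqr_ge0.
have : 0 <= \sum_t (a t * B - b t * S) ^+ 2 by exact: sum_sqr_ge0.
have -> : \sum_t (a t * B - b t * S) ^+ 2 = B * (A * B - S ^+ 2).
  rewrite (eq_bigr (fun t => B ^+ 2 * a t ^+ 2 + (- (2 * B * S)) * (a t * b t)
    + S ^+ 2 * b t ^+ 2)); last by move=> t _; ring.
  by rewrite !big_split/= -!mulr_sumr -/A -/B -/S; ring.
by rewrite pmulr_rge0// subr_ge0.
Qed.

Lemma cauchy_schwarz a b :
  `|\sum_t a t * b t| <= Num.sqrt (\sum_t a t ^+ 2) * Num.sqrt (\sum_t b t ^+ 2).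
Proof.
by rewrite -sqrtrM ?sum_sqr_ge0// -sqrtr_sqr ler_sqrt ?mulr_ge0 ?sum_sqr_ge0//
  cauchy_schwarz_sqr.
Qed.

End CauchySchwarz.

(** * Squared distances within a block, and derivative bounds in a seminorm *)

Section Blocks.
Context {R : realType} {d : nat}.
Notation V := 'rV[R]_d.
Implicit Types (f g : V -> R) (x v w z : V) (B tau : R).

Definition block_sqdist (K : finType) (iota : K -> 'I_d) (u : K -> R) tau x : R :=
  \sum_b (tau * x ord0 (iota b) - u b) ^+ 2.

(** A seminorm that sees only the coordinates of the block. Measuring directions with it, instead of
    [enorm], lets the contributions of disjoint blocks add up orthogonally. *)
Definition block_norm (K : finType) (iota : K -> 'I_d) tau v : R :=
  Num.sqrt (\sum_b (tau * v ord0 (iota b)) ^+ 2).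

Record tame B (N : V -> R) f : Prop := Tame {
  tame_smooth : smooth f;
  tame0 : forall x, `|f x| <= B;
  tame1 : forall v x, `|'D_v f x| <= B * N v;
  tame2 : forall v w x, `|'D_w ('D_v f) x| <= B * (N v * N w);
  tame3 : forall v w z x, `|'D_z ('D_w ('D_v f)) x| <= B * (N v * N w * N z) }.

(** By the Leibniz rule there are eight terms, whose bounds are exactly the eight monomials of the
    expanded right-hand side. *)
Lemma tame_mul3 B N1 N2 f g v w z x :
  (forall v, 0 <= N1 v) -> (forall v, 0 <= N2 v) ->
  tame B N1 f -> tame B N2 g ->
  `|'D_z ('D_w ('D_v (fun x => f x * g x))) x| <=
    B ^+ 2 * ((N1 v + N2 v) * (N1 w + N2 w) * (N1 z + N2 z)).
Proof.
move=> N10 N20 [sf f0 f1 f2 f3] [sg g0 g1 g2 g3].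
have D1 u h k : smooth h -> smooth k -> 'D_u (fun x => h x * k x) =
    fun x => h x * 'D_u k x + k x * 'D_u h x.
  by move=> sh sk; apply/funext => y; rewrite derive_smoothM.
have sfv u : smooth ('D_u f) by exact: smooth_derive.
have sgv u : smooth ('D_u g) by exact: smooth_derive.
have sfvw u t : smooth ('D_t ('D_u f)) by exact: smooth_derive.
have sgvw u t : smooth ('D_t ('D_u g)) by exact: smooth_derive.
have sM h k : smooth h -> smooth k -> smooth (fun x => h x * k x).
  exact: smooth_mul.
rewrite D1// (_ : 'D_w _ = fun x =>
    (f x * 'D_w ('D_v g) x + 'D_v g x * 'D_w f x) +
    (g x * 'D_w ('D_v f) x + 'D_v f x * 'D_w g x)); last first.
  by apply/funext => y; rewrite derive_smoothD ?derive_smoothM//; exact: sM.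
have sA h k h' k' : smooth h -> smooth k -> smooth h' -> smooth k' ->
    smooth (fun x => h x * k x + h' x * k' x).
  by move=> *; apply: smooth_add; exact: sM.
rewrite !(derive_smoothD, derive_smoothM)//; try exact: sM; try exact: sA.
have hM (p q P Q : R) : `|p| <= P -> `|q| <= Q -> `|p * q| <= P * Q.
  by move=> pP qQ; rewrite normrM ler_pM.
have hD (p q P Q : R) : `|p| <= P -> `|q| <= Q -> `|p + q| <= P + Q.
  by move=> pP qQ; rewrite (le_trans (ler_normD _ _))// lerD.
set lhs := (X in `|X|).
have : `|lhs| <=
  (B * (B * (N2 v * N2 w * N2 z)) + (B * (N2 v * N2 w)) * (B * N1 z) +
   ((B * N2 v) * (B * (N1 w * N1 z)) + (B * N1 w) * (B * (N2 v * N2 z)))) +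
  ((B * (B * (N1 v * N1 w * N1 z)) + (B * (N1 v * N1 w)) * (B * N2 z)) +
   ((B * N1 v) * (B * (N2 w * N2 z)) + (B * N2 w) * (B * (N1 v * N1 z)))).
  by rewrite /lhs; do 3!apply hD; apply: hM.
move/le_trans; apply; rewrite le_eqVlt; apply/orP; left; apply/eqP; ring.
Qed.

End Blocks.

Section TameProfiles.
Context {R : realType} {d : nat}.
Notation V := 'rV[R]_d.
Implicit Types (f g : V -> R) (x v w z : V) (B tau : R).

Section OneBlock.
Context {K : finType}.
Implicit Types (iota : K -> 'I_d) (u : K -> R).

Lemma smooth_affine tau c a : smooth (fun x : V => tau * x ord0 a - c).
Proof.
apply: smooth_add; last exact: smooth_cst.
by apply: smoothZ; exact: smooth_coord.
Qed.

Lemma derive_affine tau c a v x :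
  'D_v (fun x : V => tau * x ord0 a - c) x = tau * v ord0 a.
Proof.
rewrite derive_smoothD ?derive_cst ?addr0; last 2 first.
- by apply: smoothZ; exact: smooth_coord.
- exact: smooth_cst.
by rewrite derive_smoothZ ?derive_coord//; exact: smooth_coord.
Qed.

Lemma smooth_block_sqdist iota u tau : smooth (@block_sqdist R d K iota u tau).
Proof.
apply: smooth_sum => b.
have -> : (fun x : V => (tau * x ord0 (iota b) - u b) ^+ 2) = fun x =>
  (tau * x ord0 (iota b) - u b) * (tau * x ord0 (iota b) - u b).
  by apply/funext => x; rewrite expr2.
by apply: smooth_mul; exact: smooth_affine.
Qed.

Lemma derive_block_sqdist iota u tau v x :
  'D_v (@block_sqdist R d K iota u tau) x =
  2 * \sum_b (tau * x ord0 (iota b) - u b) * (tau * v ord0 (iota b)).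
Proof.
have -> : @block_sqdist R d K iota u tau = fun x => \sum_b
  (tau * x ord0 (iota b) - u b) * (tau * x ord0 (iota b) - u b).
  by apply/funext => y; apply: eq_bigr => b _; rewrite expr2.
rewrite derive_smooth_sum; last first.
  by move=> b; apply: smooth_mul; exact: smooth_affine.
rewrite mulr_sumr; apply: eq_bigr => b _.
by rewrite derive_smoothM ?derive_affine; [ring|exact: smooth_affine..].
Qed.

Lemma derive2_block_sqdist iota u tau v w x :
  'D_w ('D_v (@block_sqdist R d K iota u tau)) x =
  2 * \sum_b (tau * v ord0 (iota b)) * (tau * w ord0 (iota b)).
Proof.
have -> : 'D_v (@block_sqdist R d K iota u tau) = fun x => 2 *
  \sum_b (tau * v ord0 (iota b)) * (tau * x ord0 (iota b) - u b).
  apply/funext => y; rewrite derive_block_sqdist; congr (2 * _).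
  by apply: eq_bigr => b _; rewrite mulrC.
have sA b : smooth (fun x : V =>
    tau * v ord0 (iota b) * (tau * x ord0 (iota b) - u b)).
  by apply: smoothZ; exact: smooth_affine.
rewrite derive_smoothZ; last exact: smooth_sum.
rewrite derive_smooth_sum//; congr (2 * _); apply: eq_bigr => b _.
by rewrite derive_smoothZ ?derive_affine//; exact: smooth_affine.
Qed.

Lemma derive3_block_sqdist iota u tau v w z x :
  'D_z ('D_w ('D_v (@block_sqdist R d K iota u tau))) x = 0.
Proof.
rewrite (_ : 'D_w _ = cst (2 * \sum_b (tau * v ord0 (iota b)) *
   (tau * w ord0 (iota b)))) ?derive_cst//.
by apply/funext => y; rewrite derive2_block_sqdist.
Qed.

Lemma block_sqdist_ge0 iota u tau x : 0 <= @block_sqdist R d K iota u tau x.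
Proof. exact: sum_sqr_ge0. Qed.

Lemma block_norm_ge0 iota tau v : 0 <= @block_norm R d K iota tau v.
Proof. exact: sqrtr_ge0. Qed.

Lemma derive_block_sqdist_le iota u tau v x :
  `|'D_v (@block_sqdist R d K iota u tau) x| <=
  2 * (Num.sqrt (block_sqdist iota u tau x) * block_norm iota tau v).
Proof.
by rewrite derive_block_sqdist normrM ger0_norm// ler_wpM2l// cauchy_schwarz.
Qed.

Lemma derive2_block_sqdist_le iota u tau v w x :
  `|'D_w ('D_v (@block_sqdist R d K iota u tau)) x| <=
  2 * (block_norm iota tau v * block_norm iota tau w).
Proof.
by rewrite derive2_block_sqdist normrM ger0_norm// ler_wpM2l// cauchy_schwarz.
Qed.

End OneBlock.

(** The function [rho] stands for a squared distance. The constant 20 is dictated by order three: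
    the terms with h'' contribute 3 * 4 = 12, the one with h''' contributes 2^3 = 8, and the one
    with h' vanishes because [rho] is quadratic. *)
Lemma tame_comp (rho : V -> R) (N : V -> R) (h : nat -> R -> R) B : jet h ->
  decay_bound B h ->
  smooth rho -> (forall x, 0 <= rho x) -> (forall v, 0 <= N v) ->
  (forall v x, `|'D_v rho x| <= 2 * (Num.sqrt (rho x) * N v)) ->
  (forall v w x, `|'D_w ('D_v rho) x| <= 2 * (N v * N w)) ->
  (forall v w z x, 'D_z ('D_w ('D_v rho)) x = 0) ->
  tame (20 * B) N (fun x => h 0%N (rho x)).
Proof.
move=> hj hB sr r0 N0 d1 d2 d3.
have srv v : smooth ('D_v rho) by exact: smooth_derive.
have srvw v w : smooth ('D_w ('D_v rho)) by exact: smooth_derive.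
have sh k : smooth (fun x => h k (rho x)) by exact: smooth_comp.
have E1 v : 'D_v (fun x => h 0%N (rho x)) = fun x => h 1%N (rho x) * 'D_v rho x.
  by apply/funext => x; rewrite derive_smooth_comp.
have E2 v w x : 'D_w ('D_v (fun x => h 0%N (rho x))) x =
   h 1%N (rho x) * 'D_w ('D_v rho) x +
   h 2%N (rho x) * ('D_w rho x * 'D_v rho x).
  rewrite E1 derive_smoothM// derive_smooth_comp//.
  move: ('D_w ('D_v rho) x) ('D_w rho x) ('D_v rho x) => a b c; ring.
have E3 v w z x : 'D_z ('D_w ('D_v (fun x => h 0%N (rho x)))) x =
   h 2%N (rho x) * ('D_z rho x * 'D_w ('D_v rho) x +
     'D_w rho x * 'D_z ('D_v rho) x + 'D_v rho x * 'D_z ('D_w rho) x) +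
   h 3%N (rho x) * ('D_z rho x * 'D_w rho x * 'D_v rho x).
  have sM v' w' : smooth (fun x => 'D_w' rho x * 'D_v' rho x).
    exact: smooth_mul.
  rewrite (funext (E2 v w)) derive_smoothD; [|exact: smooth_mul..].
  rewrite !derive_smoothM// !derive_smooth_comp//.
  rewrite d3; move: ('D_z rho x) ('D_w rho x) ('D_v rho x) => a b c.
  move: ('D_w ('D_v rho) x) ('D_z ('D_v rho) x) ('D_z ('D_w rho) x) => a' b' c'.
  ring.
have hk k x (c : R) : (k <= 3)%N -> 0 <= c -> c <= (1 + rho x) ^+ 2 ->
    `|h k (rho x)| * c <= B.
  by move=> k3 c0 cle; rewrite (le_trans _ (hB k (rho x) k3 (r0 x)))// ler_wpM2l.
have s0 x : 0 <= Num.sqrt (rho x) by exact: sqrtr_ge0.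
have sE x : rho x = Num.sqrt (rho x) ^+ 2 by rewrite sqr_sqrtr.
(* The powers of the square root of [rho] met below are absorbed by the weight of [decay_bound]. *)
have c0 x : 1 <= (1 + rho x) ^+ 2 by rewrite exprn_ege1// lerDl.
have c1 x : Num.sqrt (rho x) <= (1 + rho x) ^+ 2.
  rewrite {2}(sE x); move: (Num.sqrt _) => s.
  have := sqr_ge0 (1 - s); have := sqr_ge0 s; have := sqr_ge0 (s ^+ 2); lra.
have c2 x : Num.sqrt (rho x) ^+ 2 <= (1 + rho x) ^+ 2.
  by rewrite -(sE x); have := r0 x; have := sqr_ge0 (rho x); lra.
have c3 x : Num.sqrt (rho x) ^+ 3 <= (1 + rho x) ^+ 2.
  rewrite {2}(sE x); move: (Num.sqrt _) => s.
  have := sqr_ge0 (s * (1 - s)); have := sqr_ge0 s; have := sqr_ge0 (s ^+ 2); lra.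
have B0 : 0 <= B by exact: decay_bound_ge0 hB.
split.
- exact: sh.
- move=> x; have := @hk 0%N x 1 isT ler01 (c0 x); rewrite mulr1.
  by move/le_trans; apply; rewrite ler_peMl//; lra.
- move=> v x; rewrite derive_smooth_comp// normrM.
  rewrite (le_trans (ler_wpM2l (normr_ge0 _) (d1 v x)))//.
  have := @hk 1%N x _ isT (s0 x) (c1 x) => /(ler_wpM2r (N0 v)).
  by have := mulr_ge0 B0 (N0 v); lra.
- move=> v w x; rewrite E2.
  rewrite (le_trans (ler_normD _ _))// !normrM.
  rewrite (le_trans (lerD (ler_wpM2l (normr_ge0 _) (d2 v w x))
     (ler_wpM2l (normr_ge0 _) (ler_pM _ _ (d1 w x) (d1 v x)))))//.
  have := @hk 1%N x 1 isT ler01 (c0 x).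
  have := @hk 2%N x _ isT (exprn_ge0 2 (s0 x)) (c2 x).
  have Nvw : 0 <= N v * N w by rewrite mulr_ge0.
  move=> /(ler_wpM2r Nvw) h2 /(ler_wpM2r Nvw) h1.
  rewrite (_ : _ + _ = 2 * (`|h 1%N (rho x)| * 1 * (N v * N w)) +
    4 * (`|h 2%N (rho x)| * Num.sqrt (rho x) ^+ 2 * (N v * N w))); last ring.
  have := mulr_ge0 B0 Nvw; lra.
- move=> v w z x; rewrite E3.
  have n3 (p q r P Q S : R) : `|p| <= P -> `|q| <= Q -> `|r| <= S ->
      `|p + q + r| <= P + Q + S.
    move=> pP qQ rS; rewrite (le_trans (ler_normD _ _))// lerD//.
    by rewrite (le_trans (ler_normD _ _))// lerD.
  have nM (p q P Q : R) : `|p| <= P -> `|q| <= Q -> `|p * q| <= P * Q.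
    by move=> pP qQ; rewrite normrM ler_pM.
  have h2 := n3 _ _ _ _ _ _ (nM _ _ _ _ (d1 z x) (d2 v w x))
    (nM _ _ _ _ (d1 w x) (d2 v z x)) (nM _ _ _ _ (d1 v x) (d2 w z x)).
  have h3 := nM _ _ _ _ (nM _ _ _ _ (d1 z x) (d1 w x)) (d1 v x).
  apply: le_trans (ler_normD _ _) _.
  rewrite (normrM (h 2%N _)) (normrM (h 3%N _)).
  apply: le_trans (lerD (ler_wpM2l (normr_ge0 _) h2) (ler_wpM2l (normr_ge0 _) h3)) _.
  have := @hk 2%N x _ isT (s0 x) (c1 x).
  have := @hk 3%N x _ isT (exprn_ge0 3 (s0 x)) (c3 x).
  have NN : 0 <= N v * N w * N z by rewrite !mulr_ge0.
  move=> /(ler_wpM2r NN) g3 /(ler_wpM2r NN) g2.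
  rewrite (_ : _ + _ =
    12 * (`|h 2%N (rho x)| * Num.sqrt (rho x) * (N v * N w * N z)) +
    8 * (`|h 3%N (rho x)| * Num.sqrt (rho x) ^+ 3 * (N v * N w * N z))); last ring.
  have := mulr_ge0 B0 NN; lra.
Qed.

Lemma tame_profile (K : finType) (iota : K -> 'I_d) (u : K -> R) tau
    (h : nat -> R -> R) B : jet h ->
  decay_bound B h ->
  tame (20 * B) (block_norm iota tau)
    (fun x => h 0%N (block_sqdist iota u tau x)).
Proof.
move=> hj hB; apply: tame_comp => //.
- exact: smooth_block_sqdist.
- exact: block_sqdist_ge0.
- exact: block_norm_ge0.
- exact: derive_block_sqdist_le.
- exact: derive2_block_sqdist_le.
- exact: derive3_block_sqdist.
Qed.

End TameProfiles.

Section ThirdDerivative.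
Context {R : realType} {d : nat}.
Notation V := 'rV[R]_d.
Implicit Types (f g : V -> R) (x v w z : V) (B tau : R).

Lemma derive3_smoothD f g v w z x : smooth f -> smooth g ->
  'D_z ('D_w ('D_v (fun x => f x + g x))) x =
  'D_z ('D_w ('D_v f)) x + 'D_z ('D_w ('D_v g)) x.
Proof.
move=> sf sg; rewrite (funext (fun y => derive_smoothD y v sf sg)).
have [sfv sgv] := (smooth_derive v sf, smooth_derive v sg).
rewrite (funext (fun y => derive_smoothD y w sfv sgv)).
by rewrite derive_smoothD//; apply: smooth_derive; exact: smooth_derive.
Qed.

Lemma derive3_smoothZ c f v w z x : smooth f ->
  'D_z ('D_w ('D_v (fun x => c * f x))) x = c * 'D_z ('D_w ('D_v f)) x.
Proof.
move=> sf; rewrite (funext (fun y => derive_smoothZ c y v sf)).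
rewrite (funext (fun y => derive_smoothZ c y w (smooth_derive _ sf))).
by rewrite derive_smoothZ//; apply: smooth_derive; exact: smooth_derive.
Qed.

Lemma derive3_smooth_sum (T : Type) (r : seq T) (F : T -> V -> R) v w z x :
  (forall t, smooth (F t)) ->
  'D_z ('D_w ('D_v (fun x => \sum_(t <- r) F t x))) x =
  \sum_(t <- r) 'D_z ('D_w ('D_v (F t))) x.
Proof.
move=> sF; rewrite (funext (fun y => derive_smooth_sum r y v sF)).
have sFv t : smooth ('D_v (F t)) by exact: smooth_derive.
rewrite (funext (fun y => derive_smooth_sum r y w sFv)).
by rewrite derive_smooth_sum// => t; exact: smooth_derive.
Qed.

(* Stated for variables, as unification would otherwise unfold the chain. *)
Lemma derive3_smooth_chain_form (T : finType) lam (f g : V -> R) (h : T -> V -> R)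
    v w z x : smooth f -> smooth g -> (forall t, smooth (h t)) ->
  'D_z ('D_w ('D_v f)) x = 0 ->
  'D_z ('D_w ('D_v (fun x => lam * f x + (-1) * (g x + \sum_t h t x)))) x =
  - ('D_z ('D_w ('D_v g)) x + \sum_t 'D_z ('D_w ('D_v (h t))) x).
Proof.
move=> sf sg sh f3; have sH := smooth_sum (index_enum T) sh.
have s2 := smooth_add sg sH.
apply: etrans (derive3_smoothD v w z x (smoothZ lam sf) (smoothZ (-1) s2)) _.
rewrite -[RHS]add0r; congr (_ + _).
  by apply: etrans (derive3_smoothZ lam v w z x sf) _; rewrite f3 mulr0.
apply: etrans (derive3_smoothZ (-1) v w z x s2) _; rewrite mulN1r; congr (- _).
apply: etrans (derive3_smoothD v w z x sg sH) _; congr (_ + _).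
exact: derive3_smooth_sum.
Qed.

End ThirdDerivative.

(** * The chain and its third derivative *)

Section Chain.
Context {R : realType} {d : nat} {K : finType} {m : nat}.
Notation V := 'rV[R]_d.
Variables (iota : 'I_m.+1 * K -> 'I_d) (u : 'I_m.+1 -> K -> R) (tau lam : R).
Implicit Types (x v w z : V) (j : 'I_m.+1) (k : 'I_m).

Definition node j x : R := block_sqdist (fun b => iota (j, b)) (u j) tau x.
Definition gate j x : R := bump_jet 0 (node j x).
Definition reward j x : R := gaussian_jet 0 (node j x).
Definition ridge x : R := block_sqdist iota (fun=> 0) tau x.
(** Link [k] joins block k, whose bump is the gate, to block k + 1, whose Gaussian is the reward. *)
Definition inode k : 'I_m.+1 := widen_ord (leqnSn m) k.
Definition onode k : 'I_m.+1 := lift ord0 k.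

(** The reward of block 0 has no gate, so this block is exposed from the start. The sign is a factor
    -1 so that the rules for scalar multiples apply. *)
Definition chain x : R := lam * ridge x +
  (-1) * (reward ord0 x + \sum_(k < m) gate (inode k) x * reward (onode k) x).

Lemma smooth_node j : smooth (node j).
Proof. exact: smooth_block_sqdist. Qed.

Lemma smooth_gate j : smooth (gate j).
Proof. by apply: smooth_comp; [exact: bump_jetP|exact: smooth_node]. Qed.

Lemma smooth_reward j : smooth (reward j).
Proof. by apply: smooth_comp; [exact: gaussian_jetP|exact: smooth_node]. Qed.

Lemma smooth_link k : smooth (fun x => gate (inode k) x * reward (onode k) x).
Proof. by apply: smooth_mul; [exact: smooth_gate|exact: smooth_reward]. Qed.

Lemma smooth_ridge : smooth ridge.
Proof. exact: smooth_block_sqdist. Qed.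

Lemma smooth_links :
  smooth (fun x => reward ord0 x +
    \sum_(k < m) gate (inode k) x * reward (onode k) x).
Proof.
apply: smooth_add; first exact: smooth_reward.
by apply: smooth_sum => k; exact: smooth_link.
Qed.

Lemma smooth_chain : smooth chain.
Proof.
apply: smooth_add; apply: smoothZ; first exact: smooth_ridge.
exact: smooth_links.
Qed.

Let N j v : R := block_norm (fun b => iota (j, b)) tau v.
Let NN v : R := block_norm iota tau v.

Lemma block_norm_sqr v : NN v ^+ 2 = \sum_j N j v ^+ 2.
Proof.
rewrite sqr_sqrtr ?sum_sqr_ge0//.
rewrite (eq_bigr (fun j => \sum_b (tau * v ord0 (iota (j, b))) ^+ 2)).
  by rewrite pair_bigA/=; apply: eq_bigr => -[j b].
by move=> j _; rewrite sqr_sqrtr// sum_sqr_ge0.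
Qed.

Let N0 j v : 0 <= N j v. Proof. exact: sqrtr_ge0. Qed.
Let NN0 v : 0 <= NN v. Proof. exact: sqrtr_ge0. Qed.

Lemma block_norm_le j v : N j v <= NN v.
Proof.
rewrite -ler_sqr ?nnegrE// block_norm_sqr (bigD1 j)//= lerDl sumr_ge0//.
by move=> i _; exact: sqr_ge0.
Qed.

(** Each block belongs to at most two links, so Cauchy-Schwarz over the links costs a factor 4
    whatever their number. *)
Lemma sum_link_norm v w : \sum_(k < m)
  (N (inode k) v + N (onode k) v) * (N (inode k) w + N (onode k) w) <=
  4 * (NN v * NN w).
Proof.
have h t : \sum_(k < m) (N (inode k) t + N (onode k) t) ^+ 2 <= (2 * NN t) ^+ 2.
  rewrite (@le_trans _ _ (\sum_(k < m)
    (2 * N (inode k) t ^+ 2 + 2 * N (onode k) t ^+ 2)))//.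
    apply: ler_sum => k _; have := sqr_ge0 (N (inode k) t - N (onode k) t); lra.
  rewrite big_split/= -!mulr_sumr exprMn block_norm_sqr.
  have h1 : \sum_(k < m) N (inode k) t ^+ 2 <= \sum_j N j t ^+ 2.
    rewrite big_ord_recr/= lerDl; exact: sqr_ge0.
  have h2 : \sum_(k < m) N (onode k) t ^+ 2 <= \sum_j N j t ^+ 2.
    rewrite big_ord_recl/= lerDr; exact: sqr_ge0.
  lra.
have := cauchy_schwarz (fun k : 'I_m => N (inode k) v + N (onode k) v)
  (fun k : 'I_m => N (inode k) w + N (onode k) w).
move=> /(le_trans (ler_norm _)) /le_trans; apply.
have -> : 4 * (NN v * NN w) = (2 * NN v) * (2 * NN w) by ring.
have hs t :
    Num.sqrt (\sum_(k < m) (N (inode k) t + N (onode k) t) ^+ 2) <= 2 * NN t.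
  rewrite -(ger0_norm (mulr_ge0 (ler0n R 2) (NN0 t))) -sqrtr_sqr ler_sqrt//.
  exact: sqr_ge0.
by rewrite ler_pM ?sqrtr_ge0.
Qed.

(** The bound does not grow with [m]. The quadratic ridge drops out, the first reward gives 20 B,
    and the links give (20 B)^2 times 4 from [sum_link_norm] and 2 from the third direction. *)
Lemma chain_derive3_le B v w z x :
  decay_bound B (@bump_jet R) -> decay_bound B (@gaussian_jet R) ->
  `|'D_z ('D_w ('D_v chain)) x| <=
  (20 * B + 8 * (20 * B) ^+ 2) * (NN v * NN w * NN z).
Proof.
move=> hb hg.
have B0 : 0 <= B by exact: decay_bound_ge0 hb.
have tg j : tame (20 * B) (N j) (gate j).
  by apply: tame_profile => //; exact: bump_jetP.
have tr j : tame (20 * B) (N j) (reward j).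
  by apply: tame_profile => //; exact: gaussian_jetP.
set L := (X in `|X|); have {L}-> : L = _ :=
  derive3_smooth_chain_form lam smooth_ridge (smooth_reward ord0) smooth_link
    (derive3_block_sqdist _ _ _ v w z x).
rewrite normrN.
rewrite (le_trans (ler_normD _ _))// mulrDl lerD//.
  apply: le_trans (tame3 (tr ord0) v w z x) _; rewrite ler_wpM2l ?mulr_ge0//.
  by rewrite !ler_pM ?mulr_ge0// ?block_norm_le.
apply: le_trans (ler_norm_sum _ _ _) _.
rewrite (@le_trans _ _ (\sum_(k < m) (20 * B) ^+ 2 *
  ((N (inode k) v + N (onode k) v) * (N (inode k) w + N (onode k) w) *
   (2 * NN z))))//.
  apply: ler_sum => k _.
  apply: le_trans (tame_mul3 v w z x (N0 _) (N0 _) (tg (inode k)) (tr (onode k))) _.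
  rewrite ler_wpM2l ?sqr_ge0// ler_wpM2l ?mulr_ge0 ?addr_ge0//.
  by rewrite mulr_natl mulr2n lerD// block_norm_le.
rewrite -mulr_sumr -mulr_suml.
have := ler_wpM2r (mulr_ge0 (ler0n R 2) (NN0 z)) (sum_link_norm v w).
move=> /(ler_wpM2l (sqr_ge0 (20 * B))) /le_trans; apply.
by rewrite le_eqVlt; apply/orP; left; apply/eqP; ring.
Qed.

End Chain.

(** * From third derivatives to spectral norms of Hessian differences *)

Section HessianLipschitz.
Local Open Scope classical_set_scope.
Local Open Scope ring_scope.
Context {R : realType} {d : nat}.
Notation V := 'rV[R]_d.
Implicit Types (f g : V -> R) (x y v w z : V).

Lemma enorm_ge0 v : 0 <= enorm v.
Proof. exact: sqrtr_ge0. Qed.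

Lemma enorm_sqr v : enorm v ^+ 2 = \sum_a v ord0 a ^+ 2.
Proof. by rewrite sqr_sqrtr// sum_sqr_ge0. Qed.

Lemma spectral_norm_ge0 (M : 'M[R]_d) : 0 <= spectral_norm M.
Proof.
rewrite /spectral_norm; set E := (X in sup X).
(* In the absence of a supremum, [sup] takes its default value 0. *)
have [Esup|Esup] := pselect (has_sup E); last by rewrite sup_out.
apply: ub_le_sup; first by case: Esup.
have e0 : enorm (0 : V) = 0.
  by rewrite /enorm big1 ?sqrtr0// => a _; rewrite mxE expr0n.
by exists 0; rewrite /= ?mul0mx ?e0.
Qed.

Lemma smooth_is_derive_line g y z (t : R) : smooth g ->
  is_derive t (1 : R) (fun t => g (y + t *: z)) ('D_z g (y + t *: z)).
Proof.
move=> sg; have dg := @smooth_derivable R d g (y + t *: z) z sg.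
have E :
    (fun h : R => h^-1 *: (g (y + (h *: (1 : R) + t) *: z) - g (y + t *: z))) =
    (fun h => h^-1 *: (g (h *: z + (y + t *: z)) - g (y + t *: z))).
  apply/funext => h; congr (_ *: (g _ - _)).
  by rewrite [h *: 1]mulr1 scalerDl addrCA addrA.
by apply: DeriveDef; rewrite /derivable/derive E.
Qed.

Lemma smooth_mean_value g x y (C : R) : smooth g ->
  (forall z, `|'D_(x - y) g z| <= C) -> `|g x - g y| <= C.
Proof.
move=> sg gC; pose phi (t : R) := g (y + t *: (x - y)).
have dphi (t : R) : is_derive t (1 : R) phi ('D_(x - y) g (y + t *: (x - y))).
  exact: smooth_is_derive_line.
have cphi : {within `[0, 1]%classic, continuous phi}.
  apply: continuous_subspaceT => s.
  by apply/differentiable_continuous/derivable1_diffP; case: (dphi s).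
have [c _] := MVT_segment ler01 (fun t _ => dphi t) cphi.
rewrite /phi scale1r scale0r addr0 subr0 mulr1 [y + _]addrC subrK => ->.
exact: gC.
Qed.

Lemma hessian_bilinear f x v w : smooth f ->
  \sum_b (v *m hessian f x) ord0 b * w ord0 b = 'D_v ('D_w f) x.
Proof.
move=> sf; have sp b : smooth (partial b f) by exact: smooth_derive.
rewrite (funext (fun y => derive_partial y w sf)).
rewrite derive_smooth_sum; last by move=> b; exact: smoothZ.
apply: eq_bigr => b _; rewrite derive_smoothZ// derive_partial// mulrC mxE.
by congr (_ * _); apply: eq_bigr => a _; rewrite mxE.
Qed.

(** For w the image of v, the squared norm of w is a difference of D_v D_w f between [x] and [y].
    The mean value theorem bounds it by a multiple of the norm of w, one factor of which cancels.
    The displacement keeps its own measure [M], on which the third-moment gain rests. *)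
Lemma spectral_norm_hessianB f (L : R) (M : V -> R) x y : smooth f ->
  0 <= L -> (forall z, 0 <= M z) ->
  (forall v w z x, `|'D_z ('D_w ('D_v f)) x| <= L * (enorm v * enorm w * M z)) ->
  spectral_norm (hessian f x - hessian f y) <= L * M (x - y).
Proof.
move=> sf L0 M0 f3; apply: ge_sup.
  exists (enorm (0 *m (hessian f x - hessian f y))), 0 => //=.
  by rewrite /enorm big1 ?sqrtr0// => a _; rewrite mxE expr0n.
move=> _ [v /= v1 <-]; set w := v *m _.
have mxB (p q : V) b : (p - q) ord0 b = p ord0 b - q ord0 b by rewrite !mxE.
have hw : enorm w ^+ 2 = 'D_v ('D_w f) x - 'D_v ('D_w f) y.
  rewrite -!hessian_bilinear// -sumrB enorm_sqr; apply: eq_bigr => b _.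
  rewrite -mulrBl expr2; congr (_ * _); rewrite /w mulmxBr.
  exact: mxB.
have hB : `|'D_v ('D_w f) x - 'D_v ('D_w f) y| <= L * (enorm w * M (x - y)).
  apply: (smooth_mean_value (smooth_derive v (smooth_derive w sf))) => z.
  apply: le_trans (f3 _ _ _ _) _; rewrite ler_wpM2l// -mulrA.
  by rewrite ler_wpM2l ?enorm_ge0// ler_piMl.
have [->|w0] := eqVneq (enorm w) 0; first by rewrite mulr_ge0.
have wgt0 : 0 < enorm w by rewrite lt_neqAle eq_sym w0 enorm_ge0.
rewrite -(ler_pM2l wgt0) -expr2 hw (le_trans (ler_norm _))// (le_trans hB)//.
by rewrite mulrCA.
Qed.

End HessianLipschitz.

(** * The gradient of the chain *)

Section ChainGradient.
Context {R : realType} {d : nat} {K : finType} {m : nat}.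
Notation V := 'rV[R]_d.
Implicit Types (x y v : V) (j : 'I_m.+1) (k : 'I_m).

Lemma derive_smooth_chain_form (T : finType) lam (f g : V -> R) (h : T -> V -> R)
    v x : smooth f -> smooth g -> (forall t, smooth (h t)) ->
  'D_v (fun x => lam * f x + (-1) * (g x + \sum_t h t x)) x =
  lam * 'D_v f x - ('D_v g x + \sum_t 'D_v (h t) x).
Proof.
move=> sf sg sh; have sH := smooth_sum (index_enum T) sh.
have s2 := smooth_add sg sH.
apply: etrans (derive_smoothD x v (smoothZ lam sf) (smoothZ (-1) s2)) _.
congr (_ + _); first exact: derive_smoothZ.
apply: etrans (derive_smoothZ (-1) x v s2) _; rewrite mulN1r; congr (- _).
apply: etrans (derive_smoothD x v sg sH) _; congr (_ + _).
exact: derive_smooth_sum.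
Qed.

Lemma derive_smooth_link_form (h l : nat -> R -> R) (f g : V -> R) v x :
  jet h -> jet l -> smooth f -> smooth g ->
  'D_v (fun x => h 0%N (f x) * l 0%N (g x)) x =
  h 0%N (f x) * (l 1%N (g x) * 'D_v g x) + l 0%N (g x) * (h 1%N (f x) * 'D_v f x).
Proof.
move=> hj lj sf sg.
apply: etrans (derive_smoothM x v (smooth_comp 0 hj sf) (smooth_comp 0 lj sg)) _.
by congr (_ * _ + _ * _); exact: derive_smooth_comp.
Qed.

Variables (iota : 'I_m.+1 * K -> 'I_d) (tau : R).
Variables (u : 'I_m.+1 -> K -> R) (lam : R).
Hypothesis iota_inj : injective iota.

Lemma gate_ge0 j x : 0 <= gate iota u tau j x.
Proof. by rewrite /gate bump_jet0E flat1_ge0. Qed.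

Lemma gate_le1 j x : gate iota u tau j x <= 1.
Proof. by rewrite /gate bump_jet0E flat1_le1. Qed.

Lemma rewardE j x : reward iota u tau j x = expR (- node iota u tau j x).
Proof. by rewrite /reward /gaussian_jet expr0 mul1r. Qed.

Lemma reward_ge0 j x : 0 <= reward iota u tau j x.
Proof. by rewrite rewardE expR_ge0. Qed.

Lemma node_ge0 j x : 0 <= node iota u tau j x.
Proof. exact: sum_sqr_ge0. Qed.

Lemma reward_le1 j x : reward iota u tau j x <= 1.
Proof. by rewrite rewardE -expR0 ler_expR oppr_le0 node_ge0. Qed.

Lemma partial_node i j b x :
  partial (iota (j, b)) (node iota u tau i) x =
  (i == j)%:R * (2 * tau * (tau * x ord0 (iota (j, b)) - u j b)).
Proof.
rewrite /partial derive_block_sqdist (bigD1 b)//= big1 ?addr0; last first.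
  by move=> c /negPf cb; rewrite mxE (inj_eq iota_inj) xpair_eqE cb !andbF !mulr0.
rewrite mxE (inj_eq iota_inj) xpair_eqE !eqxx andbT/=.
by case: eqP => [->|_]; [rewrite !mulr1 mul1r|rewrite !mulr0 mul0r]; ring.
Qed.

Lemma partial_ridge j b x :
  partial (iota (j, b)) (ridge iota tau) x = 2 * tau * (tau * x ord0 (iota (j, b))).
Proof.
rewrite /partial derive_block_sqdist (bigD1 (j, b))//= big1 ?addr0; last first.
  by move=> p /negPf pj; rewrite mxE (inj_eq iota_inj) pj andbF !mulr0.
by rewrite mxE !eqxx/= subr0; ring.
Qed.

(** The first term acts on the rewarded end of the link, the second on its gated end. As the bump is
    nonincreasing, both are attractions. *)
Definition link_pull j x k : R :=
  (onode k == j)%:R *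
    (gate iota u tau (inode k) x * reward iota u tau (onode k) x) -
  (inode k == j)%:R *
    (reward iota u tau (onode k) x * bump_jet 1 (node iota u tau (inode k) x)).

Definition pull j x : R :=
  (ord0 == j)%:R * reward iota u tau ord0 x + \sum_(k < m) link_pull j x k.

(* In block j the gradient is that of a ridge plus an attraction of strength
   pull towards the codeword. *)
Lemma partial_chain j b x :
  partial (iota (j, b)) (chain iota u tau lam) x =
  2 * tau * (lam * (tau * x ord0 (iota (j, b))) +
    pull j x * (tau * x ord0 (iota (j, b)) - u j b)).
Proof.
apply: etrans (derive_smooth_chain_form lam _ _ (smooth_ridge iota tau)
  (smooth_reward iota u tau ord0) (smooth_link iota u tau)) _.
have dr i : 'D_(delta_mx ord0 (iota (j, b))) (reward iota u tau i) x =
    - reward iota u tau i x * partial (iota (j, b)) (node iota u tau i) x.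
  apply: etrans (derive_smooth_comp 0 x _ gaussian_jetP (smooth_node iota u tau i)) _.
  by congr (_ * _); rewrite /reward /gaussian_jet expr1 expr0 mul1r mulN1r.
have dl k : 'D_(delta_mx ord0 (iota (j, b)))
    (fun x => gate iota u tau (inode k) x * reward iota u tau (onode k) x) x =
    gate iota u tau (inode k) x *
      (- reward iota u tau (onode k) x *
       partial (iota (j, b)) (node iota u tau (onode k)) x)
    + reward iota u tau (onode k) x *
      (bump_jet 1 (node iota u tau (inode k) x) *
       partial (iota (j, b)) (node iota u tau (inode k)) x).
  apply: etrans (derive_smooth_link_form _ _ bump_jetP gaussian_jetP
    (smooth_node iota u tau (inode k)) (smooth_node iota u tau (onode k))) _.
  by congr (_ * (_ * _) + _); rewrite /reward /gaussian_jet expr1 expr0 mul1r mulN1r.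
rewrite (eq_bigr _ (fun k _ => dl k)) dr.
have -> : 'D_(delta_mx ord0 (iota (j, b))) (ridge iota tau) x = _ :=
  partial_ridge j b x.
set X := tau * x ord0 (iota (j, b)) - u j b.
have -> : partial (iota (j, b)) (node iota u tau ord0) x = _ := partial_node _ _ _ _.
under eq_bigr => k _ do rewrite !partial_node -/X.
rewrite -/X /pull; set S := (X in _ = _ * (_ + (_ + X) * _)).
set T := (X in _ - (_ + X)); have -> : T = - (2 * tau * X) * S.
  by rewrite /S /T mulr_sumr; apply: eq_bigr => k _; rewrite /link_pull; ring.
by ring.
Qed.

Lemma link_pull_ge0 j x k : 0 <= link_pull j x k.
Proof.
rewrite /link_pull subr_ge0 (@le_trans _ _ 0)//; last first.
  by apply: mulr_ge0 => //; apply: mulr_ge0; [exact: gate_ge0|exact: reward_ge0].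
by do 2!apply: mulr_ge0_le0 => //; [exact: reward_ge0|exact: bump_jet1_le0].
Qed.

(** The value of a gate at squared distance 1/8, hence a lower bound for every gate of a solved
    block. *)
Definition gate_floor : R := flat 1 (3^-1 - 8^-1).
(** Chosen so that a block with open predecessor and squared distance at most 8 is pulled with
    strength at least 8 times the ridge weight. *)
Definition ridge_weight : R := gate_floor * expR (- 8) / 8.

Lemma gate_floor_gt0 : 0 < gate_floor.
Proof.
by rewrite /gate_floor /flat ifT ?hornerC ?mul1r ?expR_gt0//; lra.
Qed.

Lemma ridge_weight_gt0 : 0 < ridge_weight.
Proof. by rewrite divr_gt0// mulr_gt0 ?expR_gt0 ?gate_floor_gt0. Qed.

(** The link entering block [j] has an open gate, since the preceding block is solved, and all other
    terms are nonnegative. For block 0 the ungated reward takes its place. *)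
Lemma pull_lb j x : (forall i : 'I_m.+1, (i < j)%N -> node iota u tau i x <= 8^-1) ->
  gate_floor * expR (- node iota u tau j x) <= pull j x.
Proof.
move=> below.
case: (unliftP ord0 j) below => [k|] -> below; last first.
  rewrite /pull eqxx mul1r rewardE -[leLHS]addr0 lerD//; last first.
    by apply: sumr_ge0 => i _; exact: link_pull_ge0.
  by rewrite ler_piMl ?expR_ge0// flat1_le1.
move: below; rewrite -/(onode k) => below.
rewrite /pull (bigD1 k)//= addrCA {1}/link_pull eqxx mul1r -[leLHS]addr0 lerD//; last first.
  rewrite addr_ge0 ?mulr_ge0 ?reward_ge0//.
  by apply: sumr_ge0 => i _; exact: link_pull_ge0.
rewrite -[leLHS]subr0 lerB//; last first.
  do 2!apply: mulr_ge0_le0 => //; first exact: reward_ge0.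
  exact: bump_jet1_le0.
rewrite rewardE ler_wpM2r ?expR_ge0// /gate bump_jet0E flat1_homo// lerB//.
by apply: below; rewrite /= /bump/= add1n.
Qed.

End ChainGradient.

Section ChainBounds.
Context {R : realType} {d : nat} {K : finType} {m : nat}.
Variables (iota : 'I_m.+1 * K -> 'I_d) (tau : R) (u : 'I_m.+1 -> K -> R).
Hypothesis u_norm : forall j, \sum_b u j b ^+ 2 = 2.
Implicit Types (x : 'rV[R]_d) (j : 'I_m.+1).

(** Pair the block gradient, without its factor 2 tau, with the displacement X from the codeword, of
    norm r. As the codeword has norm sqrt 2, Cauchy-Schwarz gives a norm of at least (lm + G) r - lm
    sqrt 2. *)
Lemma grad_block_lb j x : injective iota ->
  (forall i : 'I_m.+1, (i < j)%N -> node iota u tau i x <= 8^-1) ->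
  8^-1 <= node iota u tau j x ->
  (2 * tau * ridge_weight) ^+ 2 <=
    \sum_b (partial (iota (j, b)) (chain iota u tau ridge_weight) x) ^+ 2.
Proof.
set lm := ridge_weight => iota_inj below open.
have lm0 : 0 < lm by exact: ridge_weight_gt0.
have hpull := pull_lb below; set G := pull iota tau u j x in hpull.
pose X b := tau * x ord0 (iota (j, b)) - u j b.
pose g b := lm * (tau * x ord0 (iota (j, b))) + G * X b.
under eq_bigr => b _ do
  rewrite (partial_chain _ _ _ iota_inj) -/lm -/G -/(X b) -/(g b) exprMn.
rewrite -mulr_sumr exprMn ler_wpM2l ?sqr_ge0//.
set r := Num.sqrt (node iota u tau j x); set S := \sum_b _.
have r2 : r ^+ 2 = node iota u tau j x by rewrite sqr_sqrtr// node_ge0.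
have rX : r ^+ 2 = \sum_b X b ^+ 2 by rewrite r2.
have r0 : 0 <= r by exact: sqrtr_ge0.
have S0 : 0 <= Num.sqrt S by exact: sqrtr_ge0.
have hgX : \sum_b g b * X b = (lm + G) * r ^+ 2 + lm * \sum_b u j b * X b.
  by rewrite rX !mulr_sumr -big_split/=; apply: eq_bigr => b _; rewrite /g /X; ring.
have h1 : \sum_b g b * X b <= Num.sqrt S * r.
  have : `|\sum_b g b * X b| <= Num.sqrt S * Num.sqrt (r ^+ 2).
    by rewrite rX; exact: cauchy_schwarz.
  by rewrite sqrtr_sqr (ger0_norm r0); apply: le_trans; exact: ler_norm.
have h2 : - (Num.sqrt 2 * r) <= \sum_b u j b * X b.
  have : `|\sum_b u j b * X b| <= Num.sqrt 2 * Num.sqrt (r ^+ 2).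
    by rewrite -(u_norm j) rX; exact: cauchy_schwarz.
  by rewrite sqrtr_sqr (ger0_norm r0) ler_norml => /andP[].
have s0 : 0 <= Num.sqrt 2 :> R by exact: sqrtr_ge0.
have s2 : Num.sqrt 2 ^+ 2 = 2 :> R by rewrite sqr_sqrtr.
have hs : Num.sqrt 2 <= 1415 / 1000 :> R by nra.
have hr : 35 / 100 <= r by move: open; rewrite -r2; nra.
have G0 : 0 <= G.
  by rewrite (le_trans _ hpull)// mulr_ge0 ?expR_ge0// ltW// gate_floor_gt0.
suff hS : lm <= Num.sqrt S.
  rewrite -(@sqr_sqrtr _ S); last exact: sum_sqr_ge0.
  by rewrite ler_sqr ?nnegrE// ltW.
have rgt0 : 0 < r by lra.
rewrite -(ler_pM2r rgt0) (le_trans _ h1)// hgX.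
(* Near the codeword, r^2 <= 8, the pull wins as G >= 8 lm and r >= 0.35. Farther away the ridge
   suffices, since r >= 2.8 > 1 + sqrt 2. *)
have key : lm * (1 + Num.sqrt 2) <= (lm + G) * r.
  have [r8|r8] := leP (r ^+ 2) 8.
    have G8 : 8 * lm <= G.
      rewrite (le_trans _ hpull)// /lm /ridge_weight -r2 mulrC divfK//.
      by rewrite ler_wpM2l ?ler_expR ?lerN2// ltW// gate_floor_gt0.
    have : lm * (1 + Num.sqrt 2) <= lm * (9 * r).
      by rewrite ler_wpM2l ?(ltW lm0)//; lra.
    have : 9 * lm * r <= (lm + G) * r by rewrite ler_wpM2r//; lra.
    lra.
  have hr2 : 28 / 10 <= r by nra.
  have : lm * (1 + Num.sqrt 2) <= lm * r by rewrite ler_wpM2l ?(ltW lm0)//; lra.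
  have : lm * r <= (lm + G) * r by rewrite ler_wpM2r//; lra.
  lra.
have := ler_wpM2r r0 key; have := ler_wpM2l (ltW lm0) h2; lra.
Qed.

Lemma first_open x : 8^-1 <= node iota u tau ord_max x -> exists j : 'I_m.+1,
  (forall i : 'I_m.+1, (i < j)%N -> node iota u tau i x <= 8^-1) /\
  8^-1 <= node iota u tau j x.
Proof.
move=> hmax; pose p j := 8^-1 <= node iota u tau j x.
case: (@arg_minnP _ ord_max p (fun i : 'I_m.+1 => i)) => // j pj jmin.
exists j; split => // i ij; rewrite leNgt; apply/negP => /ltW pi.
by have := jmin i pi; rewrite leqNgt ij.
Qed.

Lemma chain_ge lam x : 0 <= lam -> - m.+1%:R <= chain iota u tau lam x.
Proof.
move=> lam0; rewrite /chain mulN1r -[leLHS]add0r lerD ?mulr_ge0 ?sum_sqr_ge0//.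
rewrite lerN2 -addn1 natrD addrC lerD ?reward_le1//.
rewrite -[leRHS]mulr1 -[m in m%:R]card_ord -sumr_const mulr_suml.
apply: ler_sum => k _; rewrite mul1r.
by rewrite mulr_ile1 ?gate_ge0 ?gate_le1 ?reward_ge0 ?reward_le1.
Qed.

(** At the origin every node equals the squared codeword norm 2, outside the support of the bump, so
    all gates are closed. *)
Lemma chain0_le0 lam : chain iota u tau lam 0 <= 0.
Proof.
have node0 j : node iota u tau j 0 = 2.
  rewrite -(u_norm j); apply: eq_bigr => b _.
  by rewrite mxE mulr0 sub0r sqrrN.
rewrite /chain /ridge /block_sqdist big1 => [|p _]; last first.
  by rewrite mxE mulr0 subr0 expr0n.
rewrite mulr0 add0r mulN1r oppr_le0 addr_ge0 ?reward_ge0// big1// => k _.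
by rewrite /gate node0 bump_jet_eq0 ?mul0r//; lra.
Qed.

End ChainBounds.

Section ChainLocality.
Local Open Scope classical_set_scope.
Local Open Scope ring_scope.
Context {R : realType} {d : nat} {K : finType} {m : nat}.
Variables (iota : 'I_m.+1 * K -> 'I_d) (tau lam : R).
Implicit Types (u : 'I_m.+1 -> K -> R) (x : 'rV[R]_d) (i j k : 'I_m.+1).

(* The codeword of a block affects the chain only where the block before it is
   nearly solved, or where the block itself is. *)
Lemma chain_local u u' i j x :
  (forall k, k != j -> u k = u' k) -> nat_of_ord j = i.+1 ->
  2^-1 <= node iota u tau i x ->
  2^-1 <= node iota u tau j x -> 2^-1 <= node iota u' tau j x ->
  \forall y \near x, chain iota u tau lam y = chain iota u' tau lam y.
Proof.
move=> uu' ji hi hj hj'.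
(* The margin between 1/2 and 1/3 leaves a neighbourhood on which the gate vanishes identically, so
   that all derivatives agree as well. *)
have far v k : 2^-1 <= node iota v tau k x ->
    \forall y \near x, gate iota v tau k y = 0.
  move=> hk; have : 3^-1 < node iota v tau k x by apply: lt_le_trans hk; lra.
  move=> lt3; have : \forall y \near x, 3^-1 < node iota v tau k y.
    exact: (@smooth_continuous _ _ _ (smooth_node iota v tau k) x _ (lt_nbhsr lt3)).
  by apply: filterS => y /ltW; exact: bump_jet_eq0.
apply: filterS3 (far u i hi) (far u j hj) (far u' j hj') => y gi gj gj'.
have nodeE k : k != j -> node iota u tau k y = node iota u' tau k y.
  by move=> kj; rewrite /node (uu' k kj).
have gateE k : gate iota u tau k y = gate iota u' tau k y.
  have [->|kj] := eqVneq k j; first by rewrite gj gj'.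
  by rewrite /gate nodeE.
(* Block [j] has a predecessor, so its reward appears only behind the gate of block [i], which is
   closed. *)
have j0 : ord0 != j by apply/eqP => /(congr1 (@nat_of_ord _)); rewrite ji.
rewrite /chain /reward (nodeE _ j0).
congr (_ + _ * (_ + _)); apply: eq_bigr => k _; rewrite gateE.
have [kj|kj] := eqVneq (onode k) j; last by rewrite nodeE.
suff -> : gate iota u' tau (inode k) y = 0 by rewrite !mul0r.
rewrite -gateE (_ : inode k = i)//; apply/val_inj => /=.
by move/(congr1 (@nat_of_ord _)): kj; rewrite ji /= /bump/= add1n => -[].
Qed.

End ChainLocality.

(** * The family of hard instances *)

Section Code.
Context {R : realType} {w : nat}.
Implicit Types (s : 'I_w * 'I_w) (b : bool * 'I_w).

(* The codewords are the sums e_k + e'_l of a basis vector of each of two copies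
   of R^w: w ^ 2 points at mutual distance at least sqrt 2 in dimension 2 w. *)
Definition codeword s b : R := (b.2 == if b.1 then s.2 else s.1)%:R.

Lemma sum_code (F : bool * 'I_w -> R) :
  \sum_b F b = \sum_l F (true, l) + \sum_l F (false, l).
Proof.
transitivity (\sum_(c : bool) \sum_(l < w) F (c, l)).
  by rewrite pair_bigA; apply: eq_bigr => -[].
by rewrite big_bool.
Qed.

Lemma codeword_norm s : \sum_b codeword s b ^+ 2 = 2.
Proof.
have h (l0 : 'I_w) : \sum_(l < w) ((l == l0)%:R : R) ^+ 2 = 1.
  rewrite (bigD1 l0)//= eqxx big1 ?addr0 ?expr1n// => l /negPf ->.
  by rewrite expr0n.
by rewrite sum_code !h.
Qed.

(** Distinct symbols differ in at least one of the two copies, and two distinct basis vectors are at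
    squared distance 2. *)
Lemma codeword_sep s s' : s != s' -> 2 <= \sum_b (codeword s b - codeword s' b) ^+ 2.
Proof.
have h (l0 l1 : 'I_w) : l0 != l1 ->
    2 <= \sum_(l < w) ((l == l0)%:R - (l == l1)%:R : R) ^+ 2.
  move=> l01; rewrite (bigD1 l0)//= (bigD1 l1) 1?eq_sym//= !eqxx.
  rewrite [l1 == l0]eq_sym (negPf l01) subr0 sub0r sqrrN expr1n addrA lerDl.
  by apply: sumr_ge0 => l _; exact: sqr_ge0.
case: s s' => [k l] [k' l']; rewrite xpair_eqE negb_and sum_code /codeword/=.
case/orP => /h hd; apply: le_trans hd _; rewrite ?lerDr ?lerDl.
  by apply: sumr_ge0 => i _; exact: sqr_ge0.
by apply: sumr_ge0 => i _; exact: sqr_ge0.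
Qed.

End Code.

Section Instance.
Context {R : realType} {n m w : nat}.

Notation letter := (bool * 'I_w)%type.
Notation site := ('I_n * ('I_m.+1 * letter))%type.
Notation symbol := ('I_w * 'I_w)%type.
Notation d := #|{: site}|.
Notation V := 'rV[R]_d.

Definition secret := {ffun 'I_n * 'I_m.+1 -> symbol}.

Definition slot (i : 'I_n) (p : 'I_m.+1 * letter) : 'I_d := enum_rank (i, p).

Lemma slot_inj i : injective (slot i).
Proof. by move=> p p' /enum_rank_inj[]. Qed.

Variables (alpha tau lam : R).
Implicit Types (sigma : secret) (i : 'I_n) (j : 'I_m.+1) (x : V).

Definition word sigma i j : letter -> R := codeword (sigma (i, j)).

Definition component sigma i x : R :=
  alpha * chain (slot i) (word sigma i) tau lam x.

(** The radius 1/2 contains the support of the bump, yet the open balls of this squared radius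
    around distinct codewords are disjoint. *)
Definition hit sigma i j x : bool :=
  node (slot i) (word sigma i) tau j x < 2^-1.

Lemma hit_unique sigma sigma' i j x :
  hit sigma i j x -> hit sigma' i j x -> sigma (i, j) = sigma' (i, j).
Proof.
move=> h h'; apply/eqP; apply: contraT => /(@codeword_sep R) sep.
suff : \sum_b (codeword (sigma (i, j)) b - codeword (sigma' (i, j)) b) ^+ 2 <=
    2 * node (slot i) (word sigma i) tau j x +
    2 * node (slot i) (word sigma' i) tau j x.
  by move: h h' sep; rewrite /hit; lra.
rewrite !mulr_sumr -big_split/=; apply: ler_sum => b _; rewrite -/(word sigma i j).
rewrite -/(word sigma' i j) -/(word sigma' i j b).
move: (word sigma i j b) (word sigma' i j b) (tau * _) => a c t.
have := sqr_ge0 (t - a + (t - c)); lra.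
Qed.

Lemma smooth_component sigma i : smooth (component sigma i).
Proof. by apply: smoothZ; exact: smooth_chain. Qed.

Lemma component_local sigma sigma' i j' j x J :
  (forall p, p != (i, j) -> sigma p = sigma' p) -> nat_of_ord j = j'.+1 ->
  ~~ hit sigma i j' x -> ~~ hit sigma i j x -> ~~ hit sigma' i j x ->
  iter_partial J (component sigma i) x = iter_partial J (component sigma' i) x.
Proof.
move=> agree jj'; rewrite /hit -!leNgt => h1 h2 h3.
have near_eq : \forall y \near x, component sigma i y = component sigma' i y.
  have agree_i k : k != j -> word sigma i k = word sigma' i k.
    by move=> kj; rewrite /word agree// xpair_eqE eqxx.
  have := chain_local lam agree_i jj' h1 h2 h3.
  by apply: filterS => y; rewrite /component => ->.
exact: (nbhs_singleton (near_eq_iter_partial J near_eq)).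
Qed.

Lemma component_other sigma sigma' i i' j :
  (forall p, p != (i, j) -> sigma p = sigma' p) -> i' != i ->
  component sigma i' = component sigma' i'.
Proof.
move=> agree ii'; rewrite /component (_ : word sigma i' = word sigma' i')//.
by apply/funext => k; rewrite /word agree// xpair_eqE (negPf ii').
Qed.

(** * The guessing game for fixed random bits *)

Section Game.
Context {q : nat}.
Variables (A : algorithm R q n) (xi : R).

Definition query sigma t : 'I_n :=
  (step A (xi, history A (component sigma) xi t)).1.
Definition query_point sigma t : V := iterate A (component sigma) xi t.
Definition visits sigma i t : nat := \sum_(s < t) (query sigma s == i).

(* Nothing is hit beyond what the previous answers have revealed: the first
   block of every chain, and one more block at each visit. *)
Definition quiet sigma t : bool :=
  [forall i, forall j : 'I_m.+1,
     (visits sigma i t < j)%N ==> ~~ hit sigma i j (query_point sigma t)].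

Lemma visitsS sigma i t :
  visits sigma i t.+1 = (visits sigma i t + (query sigma t == i))%N.
Proof. by rewrite /visits big_ord_recr. Qed.

(** As long as both runs are quiet and chain [i] has been visited fewer than [j] times, no answer
    depends on the codeword of block [j]: a query elsewhere does not involve it, and a query to [i]
    is covered by [component_local]. *)
Lemma history_agree sigma sigma' i j t :
  (forall p, p != (i, j) -> sigma p = sigma' p) ->
  (forall s, (s < t)%N -> quiet sigma s) ->
  (forall s, (s < t)%N -> quiet sigma' s) ->
  (visits sigma i t < j)%N -> (visits sigma' i t < j)%N ->
  history A (component sigma) xi t = history A (component sigma') xi t.
Proof.
move=> agree; elim: t => [//|t IH] qt qt' vt vt'.
have ht : history A (component sigma) xi t = history A (component sigma') xi t.
  apply: IH => [s st|s st||].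
  - by apply: qt; exact: ltnW.
  - by apply: qt'; exact: ltnW.
  - by apply: leq_ltn_trans vt; rewrite visitsS leq_addr.
  - by apply: leq_ltn_trans vt'; rewrite visitsS leq_addr.
have pt : query_point sigma t = query_point sigma' t.
  by rewrite /query_point /iterate ht.
have qu : query sigma t = query sigma' t by rewrite /query ht.
suff E J : iter_partial J (component sigma (query sigma t)) (query_point sigma t) =
    iter_partial J (component sigma' (query sigma t)) (query_point sigma t).
  apply/val_inj => /=; rewrite -ht; congr (rcons _ _); congr (_, _).
  by apply: functional_extensionality_dep => k; apply/funext => J; exact: E.
have [qi|qi] := eqVneq (query sigma t) i; last by rewrite (component_other agree qi).
have vS sigma0 : query sigma0 t = i ->
    (visits sigma0 i t.+1 = (visits sigma0 i t).+1)%N.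
  by move=> qi'; rewrite visitsS qi' eqxx addn1.
rewrite (vS _ qi) in vt; rewrite (vS _ (etrans (esym qu) qi)) in vt'; rewrite qi.
have j0 : (0 < j)%N by apply: leq_trans vt.
(* The current query is itself a visit to [i], so strictly fewer than [j.-1] visits precede it and
   quietness also protects the block before [j]. *)
have jm : (j.-1 < m.+1)%N by rewrite (leq_ltn_trans (leq_pred j)).
have /forallP/(_ i)/forallP q1 := qt t (ltnSn t).
have /forallP/(_ i)/forallP q2 := qt' t (ltnSn t).
have h1 : ~~ hit sigma i (Ordinal jm) (query_point sigma t).
  by apply: (implyP (q1 _)) => /=; rewrite -ltnS prednK.
have h2 : ~~ hit sigma i j (query_point sigma t).
  by apply: (implyP (q1 _)); exact: ltnW.
have h3 : ~~ hit sigma' i j (query_point sigma' t).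
  by apply: (implyP (q2 _)); exact: ltnW.
rewrite -pt in h3.
by apply: (component_local J agree _ h1 h2 h3); rewrite /= prednK.
Qed.

Definition lucky t i j : {set secret} :=
  [set sigma | [&& [forall s : 'I_t, quiet sigma s], (visits sigma i t < j)%N
                 & hit sigma i j (query_point sigma t)]].

(** Both secrets lead to the same history, hence to the same query point, which hits at most one
    codeword. *)
Lemma lucky_unique sigma sigma' i j t :
  sigma \in lucky t i j -> sigma' \in lucky t i j ->
  (forall p, p != (i, j) -> sigma p = sigma' p) -> sigma = sigma'.
Proof.
rewrite !inE => /and3P[/forallP qs vs hs] /and3P[/forallP qs' vs' hs'] agree.
have ht : history A (component sigma) xi t = history A (component sigma') xi t.
  by apply: (history_agree agree) => // s st;
    [exact: (qs (Ordinal st))|exact: (qs' (Ordinal st))].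
apply/ffunP => p; have [->|/agree//] := eqVneq p (i, j).
by apply: hit_unique hs _; move: hs'; rewrite /query_point /iterate ht.
Qed.

(** Overwriting the symbol at [(i, j)] is injective on pairs of a lucky secret and a symbol, so a
    fraction of at most w^-2 of the secrets is lucky. *)
Lemma card_lucky t i j : (#|lucky t i j| * w ^ 2 <= #|{: secret}|)%N.
Proof.
have -> : (w ^ 2 = #|[set: symbol]|)%N by rewrite cardsT card_prod card_ord.
rewrite -cardsX.
pose upd (su : secret * symbol) : secret :=
  [ffun p => if p == (i, j) then su.2 else su.1 p].
rewrite -(@card_in_imset _ _ upd); first exact: max_card.
move=> [s y] [s' y']; rewrite !finset.in_setX => /andP[hs _] /andP[hs' _] /ffunP e.
have -> : y = y' by have := e (i, j); rewrite !ffunE eqxx.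
congr (_, _); apply: (lucky_unique hs hs') => p pij.
by have := e p; rewrite !ffunE (negPf pij).
Qed.

Lemma not_quiet_lucky sigma T : ~~ [forall t : 'I_T, quiet sigma t] ->
  exists t : 'I_T, exists i, exists j, sigma \in lucky t i j.
Proof.
rewrite negb_forall => /existsP[t0 nq].
case: (@arg_minnP _ t0 (fun t : 'I_T => ~~ quiet sigma t) (fun t => t) nq)
  => t nqt tmin.
move: nqt; rewrite negb_forall => /existsP[i]; rewrite negb_forall => /existsP[j].
rewrite negb_imply negbK => /andP[vt ht].
exists t, i, j; rewrite inE vt ht !andbT; apply/forallP => s.
apply: contraT => nqs; have sT := ltn_trans (ltn_ord s) (ltn_ord t).
by have := tmin (Ordinal sT) nqs; rewrite leqNgt /= ltn_ord.
Qed.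

(** A union bound over rounds, chains and blocks: a run that is not quiet is lucky at its first
    failing round. *)
Lemma card_not_quiet T :
  (#|[set sigma : secret | ~~ [forall t : 'I_T, quiet sigma t]]| * w ^ 2 <=
   T * (n * m.+1) * #|{: secret}|)%N.
Proof.
pose U : {set secret} :=
  \big[@finset.setU secret/finset.set0]_(p : 'I_T * ('I_n * 'I_m.+1))
    lucky p.1 p.2.1 p.2.2.
have sub : [set sigma : secret | ~~ [forall t : 'I_T, quiet sigma t]] \subset U.
  apply/fintype.subsetP => sigma; rewrite inE => /not_quiet_lucky[t [i [j h]]].
  by apply/finset.bigcupP; exists (t, (i, j)).
apply: leq_trans (leq_mul (subset_leq_card sub) (leqnn _)) _.
have cardU : (#|U| <=
    \sum_(p : 'I_T * ('I_n * 'I_m.+1)) #|lucky p.1 p.2.1 p.2.2|)%N.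
  apply: (big_ind2 (fun (B : {set secret}) k => #|B| <= k)%N) => //.
    by rewrite cards0.
  move=> B1 k1 B2 k2 h1 h2; rewrite (leq_trans _ (leq_add h1 h2))//.
  by rewrite cardsU leq_subr.
apply: leq_trans (leq_mul cardU (leqnn _)) _.
rewrite big_distrl/=.
apply: (@leq_trans (\sum_(p : 'I_T * ('I_n * 'I_m.+1)) #|{: secret}|)).
  by apply: leq_sum => p _; exact: card_lucky.
by rewrite sum_nat_const !card_prod !card_ord.
Qed.

End Game.

End Instance.

(** * Smoothness, initial gap and partial derivatives of the instances *)

Section InstanceBounds.
Local Open Scope classical_set_scope.
Local Open Scope ring_scope.
Context {R : realType} {n m w : nat}.

Notation letter := (bool * 'I_w)%type.
Notation site := ('I_n * ('I_m.+1 * letter))%type.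
Notation d := #|{: site}|.
Notation V := 'rV[R]_d.

Variables (alpha tau lam : R).
Hypotheses (alpha0 : 0 <= alpha) (tau0 : 0 <= tau).
Implicit Types (sigma : @secret n m w) (i : 'I_n) (j : 'I_m.+1) (x v z : V).

Lemma sum_site (F : 'I_d -> R) : \sum_a F a = \sum_i \sum_p F (slot i p).
Proof.
rewrite pair_bigA/= (reindex (@enum_rank site)); last first.
  exact/onW_bij/enum_rank_bij.
by apply: eq_bigr => -[i p].
Qed.

Lemma sum_slot_norm v :
  \sum_i block_norm (@slot n m w i) tau v ^+ 2 = (tau * enorm v) ^+ 2.
Proof.
rewrite exprMn enorm_sqr sum_site mulr_sumr; apply: eq_bigr => i _.
rewrite sqr_sqrtr ?sum_sqr_ge0// mulr_sumr; apply: eq_bigr => p _.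
by rewrite exprMn.
Qed.

Lemma slot_norm_le i v : block_norm (@slot n m w i) tau v <= tau * enorm v.
Proof.
rewrite -ler_sqr ?nnegrE ?sqrtr_ge0 ?mulr_ge0 ?enorm_ge0// -sum_slot_norm.
by rewrite (bigD1 i)//= lerDl sumr_ge0// => k _; exact: sqr_ge0.
Qed.

(** The Hessian of component i varies by at most a constant times the seminorm N_i of x - y that
    sees only its own coordinates. *)
Lemma component_third_moment sigma (B L2 : R) : (0 < n)%N -> 0 <= L2 ->
  decay_bound B (@bump_jet R) -> decay_bound B (@gaussian_jet R) ->
  (alpha * (20 * B + 8 * (20 * B) ^+ 2) * tau ^+ 3) ^+ 3 <= n%:R * L2 ^+ 3 ->
  third_moment_smooth L2 (component alpha tau lam sigma).
Proof.
move=> n0 L20 hb hg; set C := 20 * B + _ => hC.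
have B0 : 0 <= B by exact: decay_bound_ge0 hb.
have C0 : 0 <= C by rewrite addr_ge0 ?mulr_ge0 ?sqr_ge0.
split=> [i|x y].
  by apply: smooth_times_differentiable; exact: smooth_component.
have spec i : spectral_norm (hessian (component alpha tau lam sigma i) x
      - hessian (component alpha tau lam sigma i) y) <=
    alpha * C * tau ^+ 2 * block_norm (slot i) tau (x - y).
  apply: spectral_norm_hessianB.
  - exact: smooth_component.
  - by rewrite !mulr_ge0 ?sqr_ge0.
  - by move=> z; exact: sqrtr_ge0.
  move=> v u z t; set D3 := 'D_z _ t.
  have -> : D3 = _ := derive3_smoothZ alpha v u z t (smooth_chain _ _ _ _).
  rewrite normrM (ger0_norm alpha0).
  have step : block_norm (slot i) tau v * block_norm (slot i) tau u *
      block_norm (slot i) tau z <=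
      tau ^+ 2 * (enorm v * enorm u * block_norm (slot i) tau z).
    rewrite (_ : tau ^+ 2 * _ = (tau * enorm v) * (tau * enorm u) *
      block_norm (slot i) tau z); last by ring.
    by rewrite ler_wpM2r ?sqrtr_ge0// ler_pM ?sqrtr_ge0 ?slot_norm_le.
  have h3 := chain_derive3_le (slot i) (word sigma i) tau lam v u z t hb hg.
  apply: le_trans (ler_wpM2l alpha0 h3) _.
  by apply: le_trans (ler_wpM2l alpha0 (ler_wpM2l C0 step)) _; rewrite !mulrA.
(* In the sum of the N_i^3, one factor is bounded by the full norm and the squares add up by
   Pythagoras. The sum thus carries no factor n, and the mean gains n^-1. *)
have sum3 : \sum_i spectral_norm (hessian (component alpha tau lam sigma i) x
      - hessian (component alpha tau lam sigma i) y) ^+ 3 <=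
    (alpha * C * tau ^+ 3 * enorm (x - y)) ^+ 3.
  rewrite (_ : _ ^+ 3 = (alpha * C * tau ^+ 2) ^+ 3 * (tau * enorm (x - y)) *
     (tau * enorm (x - y)) ^+ 2); last by ring.
  rewrite -sum_slot_norm mulr_sumr; apply: ler_sum => i _.
  apply: le_trans
    (_ : (alpha * C * tau ^+ 2 * block_norm (slot i) tau (x - y)) ^+ 3 <= _).
    rewrite lerXn2r ?nnegrE ?spectral_norm_ge0//.
    by rewrite (le_trans _ (spec i)) ?spectral_norm_ge0.
  rewrite exprMn -[leRHS]mulrA ler_wpM2l ?exprn_ge0 ?mulr_ge0//.
  by rewrite exprS ler_wpM2r ?sqr_ge0// slot_norm_le.
have -> : L2 * enorm (x - y) = ((L2 * enorm (x - y)) ^+ 3) `^ 3^-1.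
  have e0 : 0 <= L2 * enorm (x - y) by rewrite mulr_ge0 ?enorm_ge0.
  by rewrite -powR_mulrn// -powRrM divff ?powRr1.
apply: ge0_ler_powR; rewrite ?nnegrE ?invr_ge0//.
- rewrite mulr_ge0 ?invr_ge0// sumr_ge0// => i _.
  by rewrite exprn_ge0 ?spectral_norm_ge0.
- by rewrite exprn_ge0// mulr_ge0 ?enorm_ge0.
rewrite ler_pdivrMl ?ltr0n//; apply: le_trans sum3 _.
rewrite [leLHS]exprMn (exprMn _ L2) [leRHS]mulrA.
by rewrite ler_wpM2r// exprn_ge0 ?enorm_ge0.
Qed.

Lemma component_gap sigma (Delta : R) : (0 < n)%N -> 0 <= lam ->
  alpha * m.+1%:R <= Delta ->
  initial_gap_le Delta (average (component alpha tau lam sigma)).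
Proof.
move=> n0 lam0 hDelta; rewrite /initial_gap_le.
have nR : 0 < n%:R :> R by rewrite ltr0n.
have avg_le (f g : 'I_n -> R) : (forall i, f i <= g i) ->
    n%:R^-1 * \sum_i f i <= n%:R^-1 * \sum_i g i.
  by move=> fg; rewrite ler_wpM2l ?invr_ge0 ?ler0n// ler_sum.
have avg_cst (c : R) : n%:R^-1 * \sum_(i < n) c = c.
  by rewrite sumr_const card_ord -[c *+ n]mulr_natl mulKf ?gt_eqF.
have F0 : average (component alpha tau lam sigma) 0 <= 0.
  rewrite -[leRHS](avg_cst 0); apply: avg_le => i.
  by rewrite mulr_ge0_le0// chain0_le0// => j; exact: codeword_norm.
have Flb x : - (alpha * m.+1%:R) <= average (component alpha tau lam sigma) x.
  rewrite -[leLHS](avg_cst _); apply: avg_le => i.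
  by rewrite -mulrN ler_wpM2l// chain_ge.
have inf_lb : ((- (alpha * m.+1%:R))%:E <=
    ereal_inf (range (EFin \o average (component alpha tau lam sigma))))%E.
  by apply: le_ereal_inf_tmp => _ [x _ <-]; rewrite lee_fin.
apply: le_trans (leeB (lexx _) inf_lb) _.
by rewrite -EFinB lee_fin; lra.
Qed.

Lemma derive_invariant f v x :
  (forall h : R, f (h *: v + x) = f x) -> 'D_v f x = 0 :> R.
Proof.
move=> fx; rewrite /derive (_ : (fun h : R => _) = cst 0) ?lim_cst//.
by apply/funext => h; rewrite /= fx subrr scaler0.
Qed.

Lemma partial_component_other sigma i i' p x : i' != i ->
  partial (slot i p) (component alpha tau lam sigma i') x = 0.
Proof.
move=> ii'; apply: derive_invariant => h.
have E p' :
    (h *: delta_mx ord0 (slot i p) + x) ord0 (slot i' p') = x ord0 (slot i' p').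
  rewrite !mxE eqxx/= (inj_eq enum_rank_inj) xpair_eqE (negPf ii') andFb.
  by rewrite mulr0 add0r.
have EN j :
    node (slot i') (word sigma i') tau j (h *: delta_mx ord0 (slot i p) + x) =
    node (slot i') (word sigma i') tau j x.
  by apply: eq_bigr => b _; rewrite E.
rewrite /component /chain; congr (_ * (_ * _ + _ * (_ + _))).
- by apply: eq_bigr => q _; rewrite E.
- by rewrite /reward EN.
- by apply: eq_bigr => k _; rewrite /gate /reward !EN.
Qed.

(** The coordinates of component [i] enter no other component, so a single term of the average
    survives. *)
Lemma partial_average sigma i p x : (0 < n)%N ->
  partial (slot i p) (average (component alpha tau lam sigma)) x =
  n%:R^-1 * alpha * partial (slot i p) (chain (slot i) (word sigma i) tau lam) x.
Proof.
move=> n0; have sc i' := smooth_component alpha tau lam sigma i'.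
apply: etrans (derive_smoothZ _ x _ (smooth_sum _ sc)) _.
rewrite -mulrA; congr (_ * _); apply: etrans (derive_smooth_sum _ x _ sc) _.
rewrite (bigD1 i)//= big1 ?addr0; last first.
  by move=> i' ii'; exact: partial_component_other.
exact: (derive_smoothZ _ x _ (smooth_chain _ _ _ _)).
Qed.

End InstanceBounds.

(** * Large gradients along quiet runs *)

Section GradientBound.
Context {R : realType} {n m w q : nat}.
Variables (alpha tau : R) (A : algorithm R q n) (xi : R).
Hypotheses (alpha0 : 0 <= alpha) (tau0 : 0 <= tau).
Let lam : R := ridge_weight.
Implicit Types (sigma : @secret n m w).

Lemma sum_visits sigma t : (\sum_i visits alpha tau lam A xi sigma i t = t)%N.
Proof.
rewrite exchange_big/= -[RHS]card_ord -sum1_card; apply: eq_bigr => s _.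
by rewrite (bigD1 (query alpha tau lam A xi sigma s))//= eqxx big1 // => i;
  rewrite eq_sym => /negPf ->.
Qed.

(** Each chain with at least [m] visits uses up [m] of the [t] rounds, so there are at most t / m <=
    n / 2 of them. *)
Lemma few_solved sigma t : (2 * t <= n * m)%N -> (0 < m)%N ->
  (n <= 2 * #|[set i | (visits alpha tau lam A xi sigma i t < m)%N]|)%N.
Proof.
move=> tn m0; set S := finset _.
have hC : (#|~: S| * m <= t)%N.
  rewrite -[leqRHS](sum_visits sigma t) -sum_nat_const.
  rewrite [leqRHS](bigID (fun i => i \in ~: S))/= -[leqLHS]addn0 leq_add//.
  by apply: leq_sum => i; rewrite !inE -leqNgt.
have := cardsC S; rewrite card_ord => hS.
have : (2 * #|~: S| <= n)%N.
  by rewrite -(leq_pmul2r m0) -mulnA (leq_trans _ tn)// leq_mul2l.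
lia.
Qed.

(** A chain with fewer than [m] visits has its last block not hit, hence a first unsolved block, to
    which [grad_block_lb] applies. At least n / 2 chains contribute in orthogonal directions, which
    yields a squared norm of at least 2 (alpha tau lam)^2 / n. *)
Lemma gradient_lb sigma t (eps : R) :
  (0 < n)%N -> (0 < m)%N -> (2 * t <= n * m)%N ->
  quiet alpha tau lam A xi sigma t -> 0 <= eps ->
  n%:R * eps ^+ 2 < 2 * (alpha * tau * lam) ^+ 2 ->
  eps < enorm (gradient (average (component alpha tau lam sigma))
    (query_point alpha tau lam A xi sigma t)).
Proof.
move=> n0 m0 tn qt eps0 heps; set x := query_point _ _ _ _ _ _ _.
set F := average _.
have nR : 0 < n%:R :> R by rewrite ltr0n.
rewrite -ltr_sqr ?nnegrE ?enorm_ge0// enorm_sqr sum_site.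
set S := [set i | (visits alpha tau lam A xi sigma i t < m)%N].
have block i : i \in S -> (n%:R^-1 * alpha) ^+ 2 * (2 * tau * lam) ^+ 2 <=
    \sum_p (gradient F x ord0 (slot i p)) ^+ 2.
  rewrite inE => vi.
  have wn j : \sum_b word sigma i j b ^+ 2 = 2 :> R by exact: codeword_norm.
  have hm : 8^-1 <= node (slot i) (word sigma i) tau ord_max x.
    have /forallP/(_ i)/forallP/(_ ord_max)/implyP := qt.
    by move=> /(_ vi); rewrite /hit -leNgt -/x; lra.
  have [j [below open]] := first_open hm.
  have := grad_block_lb wn (@slot_inj n m w i) below open.
  move=> /(ler_wpM2l (sqr_ge0 (n%:R^-1 * alpha))) /le_trans; apply.
  rewrite mulr_sumr.
  have -> : \sum_p (gradient F x ord0 (slot i p)) ^+ 2 = \sum_j \sum_b (n%:R^-1 * alpha *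
      partial (slot i (j, b)) (chain (slot i) (word sigma i) tau lam) x) ^+ 2.
    rewrite pair_bigA/=; apply: eq_bigr => -[k b] _; congr (_ ^+ 2).
    by rewrite mxE partial_average.
  rewrite [leRHS](bigD1 j)//= -[leLHS]addr0 lerD//; last first.
    by apply: sumr_ge0 => k _; exact: sum_sqr_ge0.
  by apply: ler_sum => b _; rewrite [leRHS]exprMn.
rewrite (bigID (fun i => i \in S))/=.
apply: (@lt_le_trans _ _ (\sum_(i in S)
  (n%:R^-1 * alpha) ^+ 2 * (2 * tau * lam) ^+ 2)); last first.
  rewrite -[leLHS]addr0 lerD//; first exact: ler_sum.
  by apply: sumr_ge0 => i _; exact: sum_sqr_ge0.
rewrite sumr_const -[_ *+ #|_|]mulr_natr.
have hS : n%:R <= 2 * #|S|%:R :> R by rewrite -natrM ler_nat few_solved.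
have E (N a t' l s : R) : N != 0 -> (N^-1 * a) ^+ 2 * (2 * t' * l) ^+ 2 * s =
    (2 * (a * t' * l) ^+ 2) * (2 * s) / N ^+ 2 by move=> N0; field.
rewrite E ?gt_eqF//.
rewrite ltr_pdivlMr ?exprn_gt0//.
apply: (@lt_le_trans _ _ (2 * (alpha * tau * lam) ^+ 2 * n%:R)).
  by rewrite [n%:R ^+ 2]expr2 mulrA ltr_pM2r// mulrC.
by rewrite ler_wpM2l// mulr_ge0 ?sqr_ge0.
Qed.

End GradientBound.

(** * Measurability of the iterates *)

Section Measurability.
Local Open Scope classical_set_scope.
Local Open Scope ring_scope.

(** By induction on [smooth], coordinatewise measurability of the argument is enough. *)
Lemma smooth_measurable (R : realType) (d : nat) (disp : measure_display)
    (T : measurableType disp) (f : 'rV[R]_d -> R) (X : T -> 'rV[R]_d) : smooth f ->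
  (forall a, measurable_fun setT (fun t => X t ord0 a)) ->
  measurable_fun setT (fun t => f (X t)).
Proof.
move=> sf mX; elim: sf => {f} [c|a|f g _ mf _ mg|f g _ mf _ mg|h k f hj _ mf].
- exact: measurable_cst.
- exact: mX.
- exact: measurable_funD.
- exact: measurable_funM.
- apply: (measurableT_comp (f := h k)) mf; apply: continuous_measurable_fun => s.
  by apply/differentiable_continuous; exact: jet_differentiable.
Qed.

Context {R : realType} {q n d : nat}.
Variables (A : algorithm R q n) (f : 'I_n -> 'rV[R]_d -> R).
Hypothesis smooth_f : forall i, smooth (f i).

Lemma tnth_history xi t (s : 'I_t) :
  tnth (history A f xi t) s = play A f (xi, history A f xi s).
Proof.
elim: t s => [[]//|t IH] s; rewrite (tnth_nth (tnth (history A f xi t.+1) s))/=.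
rewrite nth_rcons size_tuple; case: ltngtP => [st|ts|->]//.
- by have := IH (Ordinal st); rewrite (tnth_nth (tnth (history A f xi t.+1) s)).
- by have := ltn_ord s; rewrite ltnS leqNgt ts.
Qed.

Let index_at t xi : nat := (step A (xi, history A f xi t)).1.
Let point_at t xi : 'rV[R]_d := iterate A f xi t.

Let measurable_round t := measurable_fun setT (index_at t) /\
  forall a, measurable_fun setT (fun xi => point_at t xi ord0 a).

(** The queried index varies with the seed, so the answer is split over its finitely many values by
    indicators. *)
Let measurable_answer t J : measurable_round t ->
  measurable_fun setT (fun xi =>
    iter_partial J (f (step A (xi, history A f xi t)).1) (point_at t xi)).
Proof.
move=> [mi mx].
rewrite (_ : (fun xi => _) = fun xi => \sum_(i < n)
    \1_(index_at t @^-1` [set nat_of_ord i]) xi *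
    iter_partial J (f i) (point_at t xi)).
  apply: measurable_sum => i; apply: measurable_funM.
    by apply: measurable_indic; rewrite -[X in measurable X]setTI; exact: mi.
  by apply: smooth_measurable => //; exact: smooth_iter_partial.
apply/funext => xi; rewrite (bigD1 (step A (xi, history A f xi t)).1)//= big1 ?addr0.
  by rewrite indicE mem_set ?mul1r.
move=> i ni; rewrite indicE memNset ?mul0r//= => /val_inj e.
by rewrite e eqxx in ni.
Qed.

(** Sets of transcripts with measurable preimage form a sigma-algebra, so only the generating
    cylinders need checking. *)
Let measurable_transcript t : (forall s, (s < t)%N -> measurable_round s) ->
  forall C : set (transcript R q n d t), (<<s cylinders (d := d) (t := t) >>) C ->
  measurable [set xi : R | C (xi, history A f xi t)].
Proof.
move=> mr C; pose h xi : transcript R q n d t := (xi, history A f xi t).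
have sigma : sigma_algebra setT (image_set_system setT h measurable).
  exact/sigma_algebra_image/sigma_algebra_measurable.
suff sub : (@cylinders R q n d t) `<=` image_set_system setT h measurable.
  by move=> /(smallest_sub sigma sub); rewrite /image_set_system/= setTI.
have im (T : Type) (S : set (set T)) (g : transcript R q n d t -> T) :
    (forall B, S B -> measurable [set xi | B (g (h xi))]) ->
    preimage_set_system setT g S `<=` image_set_system setT h measurable.
  by move=> mS _ [B SB <-]; rewrite /image_set_system/= !setTI; exact: mS.
move=> D [|[s _ [[|[a _]]|[k _ [J _]]]]]; move: D; apply: im => B mB.
- exact: mB.
- have [mi _] := mr s (ltn_ord s).
  have := mi measurableT _ mB; rewrite setTI; congr measurable.
  by apply/seteqP; split => xi /=; rewrite tnth_history.
- have [_ /(_ a) mx] := mr s (ltn_ord s).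
  have := mx measurableT _ mB; rewrite setTI; congr measurable.
  by apply/seteqP; split => xi /=; rewrite tnth_history.
- have ma := measurable_answer J (mr s (ltn_ord s)).
  have := ma measurableT _ mB; rewrite setTI; congr measurable.
  by apply/seteqP; split => xi /=; rewrite tnth_history.
Qed.

Lemma measurable_rounds t : measurable_round t.
Proof.
elim/ltn_ind: t => t IH; split.
  move=> _ B mB; rewrite setTI.
  apply: (measurable_transcript IH (C := fun h => B (nat_of_ord (step A h).1))).
  by apply: (@step_index_measurable _ _ _ A); exists B => //; rewrite setTI.
move=> a _ B mB; rewrite setTI.
apply: (measurable_transcript IH (C := fun h => B ((step A h).2 ord0 a))).
by apply: (@step_point_measurable _ _ _ A _ _ a); exists B => //; rewrite setTI.
Qed.

Lemma measurable_no_stationary eps t :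
  measurable (no_stationary_until A f eps t : set (measurableTypeR R)).
Proof.
have sF : smooth (average f) by apply: smoothZ; exact: smooth_sum.
rewrite (_ : no_stationary_until _ _ _ _ = \bigcap_s [set xi | (s <= t)%N ->
    eps < enorm (gradient (average f) (iterate A f xi s))]); last first.
  by apply/seteqP; split=> xi h s; [move=> _; exact: h|exact: h].
apply: bigcapT_measurable => s; have [st|st] := boolP (s <= t)%N; last first.
  rewrite (_ : [set xi | _] = setT)//.
  by apply/seteqP; split => // xi _ /=; rewrite (negPf st).
rewrite (_ : [set xi | _] =
    [set xi | eps < enorm (gradient (average f) (iterate A f xi s))]).
  have m : measurable_fun setT
      (fun xi => enorm (gradient (average f) (iterate A f xi s))).
    apply: (measurableT_comp (f := @Num.sqrt R)).
      by apply: continuous_measurable_fun; exact: sqrt_continuous.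
    apply: measurable_sum => a; apply: measurable_funX.
    rewrite (_ : (fun xi => _) =
        fun xi => partial a (average f) (iterate A f xi s)).
      apply: smooth_measurable; first exact: smooth_derive.
      by have [] := measurable_rounds s.
    by apply/funext => xi; rewrite mxE.
  have := m measurableT _ (measurable_itv `]eps, +oo[); rewrite setTI.
  by congr measurable; apply/seteqP; split => xi /=; rewrite in_itv/= andbT.
by apply/seteqP; split => xi /=; [apply|].
Qed.

End Measurability.

(** * Averaging over the random bits *)

Section Averaging.
Local Open Scope classical_set_scope.
Local Open Scope ring_scope.

(** If every event had probability at most 1/2, the expected number of events that occur would be at
    most half of them, against at least 3/4 pointwise. *)
Lemma exists_likely (R : realType) (disp : measure_display)
    (T : measurableType disp) (P : probability T R) (I : finType) (E : I -> set T) : (0 < #|I|)%N ->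
  (forall i, measurable (E i)) ->
  (forall x, (3 / 4) * #|I|%:R <= \sum_i \1_(E i) x :> R) ->
  exists i, ((2^-1)%:E < P (E i))%E.
Proof.
move=> I0 mE large; apply: contrapT => /forallNP small.
have IR : 0 < #|I|%:R :> R by rewrite ltr0n.
have m1 i : measurable_fun setT (fun x => (\1_(E i) x)%:E : \bar R).
  by apply/measurable_EFinP; exact: measurable_indic.
have hi : (\int[P]_x (\sum_i (\1_(E i) x)%:E) <= (2^-1 * #|I|%:R)%:E)%E.
  have h0 i x : setT x -> (0 <= (\1_(E i) x)%:E :> \bar R)%E.
    by rewrite lee_fin indicE.
  rewrite (ge0_integral_sum P measurableT m1 h0).
  apply: (@le_trans _ _ (\sum_(i : I) (2^-1)%:E)%E).
    apply: lee_sum => i _; rewrite integral_indic// setIT leNgt.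
    by apply/negP; exact: small.
  by rewrite sumEFin lee_fin sumr_const mulr_natr.
have lo : (((3 / 4) * #|I|%:R)%:E <= \int[P]_x (\sum_i (\1_(E i) x)%:E))%E.
  apply: (@le_trans _ _ (\int[P]_(x in setT) (cst ((3 / 4) * #|I|%:R)%:E x))%E).
    rewrite integral_cst// [X in (_ * X)%E](_ : _ = 1%E) ?mule1//.
    exact: probability_setT.
  apply: ge0_le_integral => //.
  - by move=> x _; rewrite lee_fin mulr_ge0// ltW.
  - by apply: emeasurable_sum => i; exact: m1.
  - by move=> x _; rewrite sumEFin lee_fin; exact: large.
have := le_trans lo hi; rewrite lee_fin; lra.
Qed.

End Averaging.

(** * The lower bound *)

Section LowerBound.
Local Open Scope classical_set_scope.
Local Open Scope ring_scope.
Context {R : realType} {q n m : nat}.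
Variables (A : algorithm R q n) (alpha tau eps : R).
Hypotheses (alpha0 : 0 <= alpha) (tau0 : 0 <= tau) (eps0 : 0 <= eps).
Hypotheses (n0 : (0 < n)%N) (m0 : (0 < m)%N).
Let lam : R := ridge_weight.
(** With this size w^2 = 4 (n (m + 1))^2, so the union bound over at most n (m + 1) rounds leaves at
    most a quarter of the secrets. *)
Let w := (2 * (n * m.+1))%N.
(** Counts the rounds t = 0, ..., floor(n m / 2), those with 2 t <= n m. *)
Let T := (n * m)./2.+1.
Implicit Types (sigma : @secret n m w).

Let nm0 : (0 < n * m.+1)%N. Proof. by rewrite muln_gt0 n0. Qed.

Lemma card_secret_gt0 : (0 < #|{: @secret n m w}|)%N.
Proof.
rewrite card_ffun card_prod card_ord expn_gt0 muln_gt0 andbb.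
by rewrite /w muln_gt0 nm0.
Qed.

Lemma few_not_quiet xi :
  (4 * #|[set sigma : @secret n m w |
          ~~ [forall t : 'I_T, quiet alpha tau lam A xi sigma t]]%SET| <=
   #|{: @secret n m w}|)%N.
Proof.
have := card_not_quiet alpha tau lam A xi T (m := m) (w := w).
set N := #|finset _|; set S := #|_| => hN.
have TS : (T <= n * m.+1)%N by rewrite /T mulnS; lia.
have P0 : (0 < (n * m.+1) ^ 2)%N by rewrite expn_gt0 nm0.
rewrite -(leq_pmul2r P0).
rewrite (_ : 4 * N * _ = N * w ^ 2)%N; last by rewrite /w expnMn; lia.
rewrite (leq_trans hN)// [leqRHS]mulnC leq_mul2r; apply/orP; right.
by rewrite expnS expn1 leq_mul2r TS orbT.
Qed.

Lemma exists_slow_instance : n%:R * eps ^+ 2 < 2 * (alpha * tau * lam) ^+ 2 ->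
  exists sigma, (T%:R%:E <= complexity A (component alpha tau lam sigma) eps)%E.
Proof.
move=> heps.
pose E sigma := no_stationary_until A (component alpha tau lam sigma) eps (n * m)./2.
have sc sigma i := smooth_component alpha tau lam sigma i.
have mE sigma : measurable (E sigma : set (measurableTypeR R)).
  by apply: measurable_no_stationary => i; exact: sc.
have quietE xi sigma :
    [forall t : 'I_T, quiet alpha tau lam A xi sigma t] -> E sigma xi.
  move=> /forallP qt s sT; have := qt (Ordinal (sT : (s < T)%N)) => /= qs.
  apply: gradient_lb => //; move: sT; lia.
have large xi :
    (3 / 4) * #|{: @secret n m w}|%:R <= \sum_sigma \1_(E sigma) xi :> R.
  have := few_not_quiet xi; set N := #|finset _| => hN.
  pose G := [set sigma : @secret n m w |
    [forall t : 'I_T, quiet alpha tau lam A xi sigma t]]%SET.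
  have GN : (#|{: @secret n m w}| = #|G| + N)%N.
    rewrite -(cardsC G); congr (_ + _)%N; apply: eq_card => sigma.
    by rewrite !inE.
  have : (#|G|%:R : R) <= \sum_sigma \1_(E sigma) xi.
    rewrite (bigID (fun sigma => sigma \in G))/= -[leLHS]addr0 lerD//; last first.
      by apply: sumr_ge0 => sigma _; rewrite indicE.
    rewrite -sum1_card natr_sum; apply: ler_sum => sigma.
    rewrite inE => /quietE Es.
    by rewrite indicE mem_set.
  apply: le_trans; rewrite GN natrD.
  have : 4 * N%:R <= #|G|%:R + N%:R :> R by rewrite -natrD -natrM ler_nat -GN.
  lra.
have [sigma likely] :=
  exists_likely (uniform_prob (@ltr01 R)) card_secret_gt0 mE large.
exists sigma; apply: le_ereal_inf_tmp => _ [t /= ht <-].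
rewrite lee_fin ler_nat leqNgt; apply/negP; rewrite /T ltnS => tT.
(* For t < T, lasting until round floor(n m / 2) implies lasting until round t, so a qualifying t
   would bring the likely event down to probability 1/2. *)
suff small : (uniform_prob (@ltr01 R) (E sigma) <= (2^-1)%:E)%E.
  by move: likely; rewrite ltNge small.
have mt : measurable (no_stationary_until A (component alpha tau lam sigma) eps t :
    set (measurableTypeR R)).
  by apply: measurable_no_stationary => i; exact: sc.
refine (le_trans _ ht).
apply: (le_measure (uniform_prob (@ltr01 R)) (mem_set (mE sigma)) (mem_set mt)).
by move=> xi h s st; apply: h; exact: leq_trans tT.
Qed.

End LowerBound.

Lemma powR_half_sqr (R : realType) (x : R) : 0 <= x -> (x `^ (1 / 2)) ^+ 2 = x.
Proof.
by move=> x0; rewrite -powR_mulrn ?powR_ge0// -powRrM mul1r mulVf ?powRr1.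
Qed.

Unset Implicit Arguments.

Theorem theorem4p10 (R : realType) :
  exists (c C : R) (k : nat), 0 < c /\ 0 < C /\
  forall Delta : R, 0 < Delta ->
  exists K : R, 0 < K /\
  forall (q n : nat) (A : algorithm R q n) (L2 eps : R),
    (1 <= n)%N -> 0 < L2 -> 0 < eps ->
    n%:R <= c * Delta `^ (12 / 7) * L2 `^ (6 / 7)
              / eps `^ (18 / 7) ->
  exists (d : nat) (f : 'I_n -> 'rV[R]_d -> R),
    d%:R <= K * (n%:R ^+ 2 * Delta * L2 * eps ^- 3)
              * ln (2 + d%:R + n%:R + eps^-1) ^+ k
    /\ (forall i : 'I_n, times_differentiable q (f i))
    /\ third_moment_smooth L2 f
    /\ initial_gap_le Delta (average f)
    /\ ((C * (L2 `^ (1 / 2) * Delta * n%:R `^ (5 / 12)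
              / eps `^ (3 / 2)))%:E <= complexity A f eps)%E.
Proof.
have le_half (j : nat) : (j <= 2 * j./2.+1)%N by lia.
have [Bb Bb0 hBb] := @bump_jet_bounded R; pose B := Bb + 4.
have hb : decay_bound B (@bump_jet R) by apply: decay_boundW hBb _; rewrite lerDl.
have hg : decay_bound B (@gaussian_jet R).
  by apply: decay_boundW gaussian_jet_bounded _; rewrite lerDr.
pose Lambda := 20 * B + 8 * (20 * B) ^+ 2.
have B0 : 0 < B by rewrite /B; lra.
have Lambda0 : 0 < Lambda by rewrite addr_gt0 ?mulr_gt0 ?exprn_gt0 ?mulr_gt0.
pose lam : R := ridge_weight; have lam0 : 0 < lam := ridge_weight_gt0.
(* The factor [kap] normalises the gradient bound, [mu] is large enough that kap Lambda <= mu^2 for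
   the smoothness bound, and [g] makes alpha tau lam free of constants. *)
pose kap := lam^-1; have kap0 : 0 < kap by rewrite invr_gt0.
pose mu := 1 + kap * Lambda.
have mu0 : 0 < mu by rewrite addr_gt0 ?mulr_gt0.
pose g := kap * mu; have g0 : 0 < g by rewrite mulr_gt0.
exists ((2 * g)^-1 `^ (12 / 7)), ((8 * g)^-1), 0%N.
split; first by rewrite powR_gt0 ?invr_gt0 ?mulr_gt0.
split; first by rewrite invr_gt0 mulr_gt0.
(* The dimension is quadratic in the number of blocks, itself proportional to [Delta]; one of the
   two factors [Delta] goes into the constant. *)
move=> Delta Delta0; exists (4 * Delta / g ^+ 2).
split; first by rewrite divr_gt0 ?exprn_gt0 ?mulr_gt0.
move=> q n A L2 eps n0 L20 eps0 hn.
(* In these roots all the fractional powers become integer ones, within reach of [field] and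
   [ring]. *)
pose a : R := n%:R `^ (1 / 12); pose l : R := L2 `^ (1 / 2).
pose e : R := eps `^ (1 / 2).
have nR : 0 < n%:R :> R by rewrite ltr0n.
have a0 : 0 < a by rewrite powR_gt0.
have l0 : 0 < l by rewrite powR_gt0.
have e0 : 0 < e by rewrite powR_gt0.
have aE : a ^+ 12 = n%:R.
  by rewrite -powR_mulrn ?(ltW a0)// -powRrM mul1r mulVf ?powRr1 ?(ltW nR).
have lE : l ^+ 2 = L2 by rewrite powR_half_sqr// ltW.
have eE : e ^+ 2 = eps by rewrite powR_half_sqr// ltW.
have a1 : 1 <= a.
  by rewrite -(powRr0 n%:R) ler_powR ?ler1n.
have n5 : n%:R `^ (5 / 12) = a ^+ 5.
  by rewrite -powR_mulrn ?(ltW a0)// -powRrM; congr (_ `^ _); field.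
have e3 : eps `^ (3 / 2) = e ^+ 3.
  by rewrite -powR_mulrn ?(ltW e0)// -powRrM; congr (_ `^ _); field.
(* The assumed bound on [n] is a^12 <= Y^(12/7), with Y the right-hand side here; comparing [a] with
   Y^(1/7) gives the claim. *)
have ha : a ^+ 7 <= Delta * l / (2 * g * e ^+ 3).
  set Y := Delta * l / _; have Y0 : 0 < Y by rewrite divr_gt0 ?mulr_gt0 ?exprn_gt0.
  have hY : n%:R <= Y `^ (12 / 7).
    apply: le_trans hn _; rewrite le_eqVlt; apply/orP; left; apply/eqP.
    have -> : Y = (2 * g)^-1 * Delta * l * eps `^ (- (3 / 2)).
      by rewrite powRN e3 /Y; field; rewrite !gt_eqF.
    have i0 : 0 <= (2 * g)^-1 by rewrite invr_ge0 mulr_ge0// ltW.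
    rewrite !powRM ?mulr_ge0 ?powR_ge0 ?(ltW Delta0)//.
    rewrite -!powRrM -powRN; congr (_ * _ * _ `^ _ * _ `^ _); by field.
  pose y := Y `^ (1 / 7); have y0 : 0 <= y by exact: powR_ge0.
  have y7 : y ^+ 7 = Y by rewrite -powR_mulrn// -powRrM mul1r mulVf ?powRr1// ltW.
  have y12 : y ^+ 12 = Y `^ (12 / 7).
    by rewrite -powR_mulrn// -powRrM; congr (_ `^ _); field.
  rewrite -y7 ler_pXn2r ?nnegrE ?(ltW a0)//.
  by rewrite -(@ler_pXn2r _ 12) ?nnegrE ?(ltW a0)// aE y12.
(* The two scales solve alpha tau lam = n^(1/2) eps, for the gradient, and alpha Lambda tau^3 <=
   n^(1/3) L2, for the third moment. *)
pose alpha := g * a ^+ 7 * e ^+ 3 / l; pose tau := l / (mu * a * e).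
have alpha0 : 0 < alpha by rewrite divr_gt0 ?mulr_gt0 ?exprn_gt0.
have tau0 : 0 < tau by rewrite divr_gt0 ?mulr_gt0.
pose Z := Delta / alpha; have Z0 : 0 <= Z by rewrite divr_ge0 ?ltW.
have Z2 : 2 <= Z.
  have -> : Z = Delta * l / (2 * g * e ^+ 3) * 2 / a ^+ 7.
    by rewrite /Z /alpha; field; rewrite !gt_eqF.
  by rewrite ler_pdivlMr ?exprn_gt0// mulrC ler_wpM2r.
(* The gap allows alpha (m + 1) <= Delta, so m + 1 is the integer part of [Z]; as Z >= 2, there is
   at least one link. *)
have /andP[MZ ZM] := truncn_itv Z0; case: (Num.truncn Z) MZ ZM => [|m] MZ ZM.
  by move: ZM; lra.
have m0 : (0 < m)%N.
  by rewrite lt0n; apply/eqP => m0; move: ZM; rewrite m0; lra.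
have at_lam : alpha * tau * lam = a ^+ 6 * e ^+ 2.
  by rewrite /alpha /tau /g /kap; field; rewrite !gt_eqF.
have heps : n%:R * eps ^+ 2 < 2 * (alpha * tau * lam) ^+ 2.
  rewrite at_lam -aE -eE (_ : 2 * _ = 2 * (a ^+ 12 * (e ^+ 2) ^+ 2)); last by ring.
  by rewrite ltr_pMl ?mulr_gt0 ?exprn_gt0// ltr1n.
have h3 : (alpha * Lambda * tau ^+ 3) ^+ 3 <= n%:R * L2 ^+ 3.
  have -> : alpha * Lambda * tau ^+ 3 = (kap * Lambda / mu ^+ 2) * (a ^+ 4 * l ^+ 2).
    by rewrite /alpha /tau /g; field; rewrite !gt_eqF.
  have -> : n%:R * L2 ^+ 3 = (a ^+ 4 * l ^+ 2) ^+ 3 by rewrite -aE -lE; ring.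
  rewrite ler_pXn2r ?nnegrE ?mulr_ge0 ?exprn_ge0 ?invr_ge0 ?exprn_ge0 ?ltW//.
  rewrite gtr_pMl ?mulr_gt0 ?exprn_gt0// ltr_pdivrMr ?exprn_gt0// mul1r.
  have kL : 0 < kap * Lambda by rewrite mulr_gt0.
  by rewrite /mu expr2; nra.
have [sigma slow] :=
  exists_slow_instance A (ltW alpha0) (ltW tau0) (ltW eps0) n0 m0 heps.
exists _, (component alpha tau lam sigma).
split; last split; last split; last split.
- rewrite expr0 mulr1 !card_prod !card_ord card_bool.
  have -> : 4 * Delta / g ^+ 2 * (n%:R ^+ 2 * Delta * L2 * eps ^- 3) =
      4 * n%:R ^+ 2 * (Z * a ^+ 7) ^+ 2.
    by rewrite /Z /alpha -lE -eE; field; rewrite !gt_eqF.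
  have -> : (n * (m.+1 * (2 * (2 * (n * m.+1)))))%:R =
      4 * n%:R ^+ 2 * m.+1%:R ^+ 2 :> R.
    by rewrite !natrM; ring.
  have Za : 0 <= Z * a ^+ 7 by apply: mulr_ge0 => //; rewrite exprn_ge0// ltW.
  rewrite ler_wpM2l ?mulr_ge0 ?exprn_ge0// ler_pXn2r ?nnegrE//.
  by rewrite (le_trans MZ)// ler_peMr// exprn_ege1.
- by move=> i; apply: smooth_times_differentiable; exact: smooth_component.
- exact: (component_third_moment _ (ltW alpha0) (ltW tau0) _ n0 (ltW L20)
    hb hg h3).
- apply: (@component_gap _ _ _ _ alpha tau lam (ltW alpha0) sigma Delta n0
    (ltW lam0)).
  by rewrite mulrC -ler_pdivlMr.
apply: le_trans slow; rewrite lee_fin n5 e3 -/l.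
have -> : (8 * g)^-1 * (l * Delta * a ^+ 5 / e ^+ 3) = n%:R * Z / 8.
  by rewrite -aE /Z /alpha; field; rewrite !gt_eqF.
have hT : n%:R * m%:R <= 2 * (n * m)./2.+1%:R :> R.
  by rewrite -!natrM ler_nat.
(* From Z < m + 2 and m >= 1. With T >= n m / 2 this gives T >= n Z / 8, whence the 8 in the
   constant. *)
have hm : Z <= 4 * m%:R.
  move: ZM; rewrite -!natr1; have : 1 <= m%:R :> R by rewrite ler1n.
  lra.
have := ler_wpM2l (ltW nR) hm; lra.
Qed.
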